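(* Let $A$ be a unitarizable Hopf $*$-algebra and $Z$ an $A$-$*$-Galois extension with a positive Haar measure. Let $\widehat A$ be the set of isomorphism classes of irreducible finite-dimensional $A$-comodules and $n_\lambda$ the dimension of a representative of $\lambda\in\widehat A$. Then $Z=\bigoplus_{\lambda\in\widehat A}Z(\lambda)$ where each $Z(\lambda)$ is a sub-$A$-comodule of dimension $n_\lambda p_\lambda$ for some positive integer $p_\lambda$; for each $\lambda$ there is a basis $(z^\lambda_{ij})_{1\le i\le n_\lambda,1\le j\le p_\lambda}$ of $Z(\lambda)$ with $\sum_{i=1}^{n_\lambda}(z^\lambda_{ij})^*z^\lambda_{ik}=\delta_{jk}$ and $\sum_{j=1}^{p_\lambda}z^\lambda_{ij}(z^\lambda_{kj})^*=\delta_{ik}$; and there is a basis $(a^\lambda_{ij})_{\lambda\in\widehat A,1\le i,j\le n_\lambda}$ of $A$ such that each matrix $(a^\lambda_{ij})_{i,j}$ is unitary and $\alpha_Z(z^\lambda_{ij})=\sum_{k=1}^{n_\lambda}a^\lambda_{ik}\otimes z^\lambda_{kj}$.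
   Context: Base field $\mathbb C$. A Hopf $*$-algebra is a Hopf algebra that is a $*$-algebra with $\Delta$ a $*$-homomorphism; unitarizable means every finite-dimensional right comodule $V$ admits a scalar product $\phi_V:\overline V\otimes V\to\mathbb C$ that is a comodule map ($\overline V$ the conjugate comodule, $\overline v\mapsto\sum\overline{v_i}\otimes a_i^*$ if $\alpha_V(v)=\sum v_i\otimes a_i$). An $A$-$*$-Galois extension is a nonzero $*$-algebra $Z$ with a left coaction $\alpha_Z:Z\to A\otimes Z$ that is a $*$-homomorphism and with $(1_A\otimes m_Z)(\alpha_Z\otimes 1_Z):Z\otimes Z\to A\otimes Z$ bijective. A Haar measure on $Z$: linear $\mu$ with $(1_A\otimes\mu)\alpha_Z=\mu(\cdot)1_A$, $\mu(1)=1$; positive if $\mu(z^*z)\ge0$. A matrix $(a_{ij})$ over a $*$-algebra is unitary if $a^*a=aa^*=1$ with $(a^* )_{ij}=a_{ji}^*$. *)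

(* Defs.v *)
From HB Require Import structures.
From mathcomp Require Import all_boot all_order all_algebra.
From mathcomp Require Import complex Rstruct.
Set Implicit Arguments. Unset Strict Implicit. Unset Printing Implicit Defensive.
Import Order.TTheory GRing.Theory Num.Theory.
Local Open Scope ring_scope.

Notation C := (Rdefinitions.R[i]).

(** Algebraic tensors U ⊗ V are represented by finite sums of elementary
    tensors, i.e. by lists of pairs; two representatives denote the same
    tensor iff they agree on all products of linear functionals
    (V ⊗ W embeds into bilinear forms on V^* × W^*, over a field). *)
Definition teq (U V : lmodType C) (s t : seq (U * V)) : Prop :=
  forall (f : {scalar U}) (g : {scalar V}),
    \sum_(p <- s) f p.1 * g p.2 = \sum_(p <- t) f p.1 * g p.2.

Definition teq3 (U V W : lmodType C) (s t : seq ((U * V) * W)) : Prop :=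
  forall (f : {scalar U}) (g : {scalar V}) (h : {scalar W}),
    \sum_(p <- s) f p.1.1 * g p.1.2 * h p.2
    = \sum_(p <- t) f p.1.1 * g p.1.2 * h p.2.

Definition tmul (A B : algType C) (s t : seq (A * B)) : seq (A * B) :=
  [seq (p.1 * q.1, p.2 * q.2) | p <- s, q <- t].

Definition tlinear (U V W : lmodType C) (d : U -> seq (V * W)) : Prop :=
  forall (c : C) (x y : U),
    teq (d (c *: x + y)) ([seq (c *: p.1, p.2) | p <- d x] ++ d y).

Definition star_structure (A : algType C) (st : A -> A) : Prop :=
  [/\ involutive st,
      forall x y : A, st (x + y) = st x + st y,
      forall (c : C) (x : A), st (c *: x) = c^* *: st x
    & forall x y : A, st (x * y) = st y * st x].

Definition is_hopf_star_algebra (A : algType C) (Delta : A -> seq (A * A))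
    (eps : A -> C) (S : A -> A) (st : A -> A) : Prop :=
  [/\
      [/\ tlinear Delta,
          (forall x y, teq (Delta (x * y)) (tmul (Delta x) (Delta y))),
          teq (Delta 1) [:: (1, 1)]
        & forall x,
            teq3 [seq ((q.1, q.2), p.2) | p <- Delta x, q <- Delta p.1]
                 [seq ((p.1, q.1), q.2) | p <- Delta x, q <- Delta p.2]],
      [/\ forall (c : C) x y, eps (c *: x + y) = c * eps x + eps y,
          forall x y, eps (x * y) = eps x * eps y,
          eps 1 = 1,
          forall x, \sum_(p <- Delta x) eps p.1 *: p.2 = x
        & forall x, \sum_(p <- Delta x) eps p.2 *: p.1 = x],
      [/\ forall (c : C) x y, S (c *: x + y) = c *: S x + S y,
          forall x, \sum_(p <- Delta x) S p.1 * p.2 = (eps x)%:A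
        & forall x, \sum_(p <- Delta x) p.1 * S p.2 = (eps x)%:A],
      star_structure st
    & forall x, teq (Delta (st x)) [seq (st p.1, st p.2) | p <- Delta x]].

(** Matrix corepresentations: u ∈ M_n(A) with Δ(u_ij) = Σ_k u_ik ⊗ u_kj and
    ε(u_ij) = δ_ij.  These are exactly the coefficient matrices of the
    n-dimensional right comodules C^n with α(e_j) = Σ_i e_i ⊗ u_ij. *)
Definition is_corep (A : algType C) (Delta : A -> seq (A * A)) (eps : A -> C)
    (n : nat) (u : 'M[A]_n) : Prop :=
  (forall i j, teq (Delta (u i j)) [seq (u i k, u k j) | k <- enum 'I_n]) /\
  (forall i j, eps (u i j) = (i == j)%:R).

(** Unitarizability: every finite-dimensional comodule C^n (with coaction
    given by a corepresentation u) carries a scalar product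
    φ(ē_i ⊗ e_k) = H_ik (H positive definite Hermitian) that is a comodule
    map V̄ ⊗ V -> C, i.e. Σ_{i,k} H_ik u_ij^* u_km = H_jm 1. *)
Definition unitarizable (A : algType C) (Delta : A -> seq (A * A))
    (eps : A -> C) (st : A -> A) : Prop :=
  forall (n : nat) (u : 'M[A]_n), is_corep Delta eps u ->
  exists H : 'M[C]_n,
    [/\ forall i j, H j i = (H i j)^*,
        forall v : 'cV[C]_n, v != 0 -> 0 < ((map_mx Num.conj v)^T *m H *m v) 0 0
      & forall j m, \sum_i \sum_k H i k *: (st (u i j) * u k m) = H j m *: 1].

Definition is_star_galois (A Z : algType C) (Delta : A -> seq (A * A))
    (eps : A -> C) (stA : A -> A) (stZ : Z -> Z) (alpha : Z -> seq (A * Z))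
    : Prop :=
  [/\ (1 : Z) != 0,
      star_structure stZ,
      [/\ tlinear alpha,
          (forall z, teq3 [seq ((p.1, q.1), q.2) | p <- alpha z, q <- alpha p.2]
                          [seq ((q.1, q.2), p.2) | p <- alpha z, q <- Delta p.1])
        & forall z, \sum_(p <- alpha z) eps p.1 *: p.2 = z],
      [/\ forall z w, teq (alpha (z * w)) (tmul (alpha z) (alpha w)),
          teq (alpha 1) [:: (1, 1)]
        & forall z, teq (alpha (stZ z)) [seq (stA p.1, stZ p.2) | p <- alpha z]]
    &
      let beta (t : seq (Z * Z)) : seq (A * Z) :=
        [seq (q.1, q.2 * p.2) | p <- t, q <- alpha p.1] in
      (forall t, teq (beta t) [::] -> teq t [::]) /\
      (forall s : seq (A * Z), exists t, teq (beta t) s)].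

Definition positive_haar_measure (A Z : algType C) (alpha : Z -> seq (A * Z))
    (stZ : Z -> Z) (mu : Z -> C) : Prop :=
  [/\ forall (c : C) x y, mu (c *: x + y) = c * mu x + mu y,
      forall z, \sum_(p <- alpha z) mu p.2 *: p.1 = mu z *: (1 : A),
      mu 1 = 1
    & forall z, 0 <= mu (stZ z * z)].

(** Irreducible corepresentation: n > 0 and C^n has no comodule subspaces
    besides 0 and C^n.  A subspace (row space of W, in coordinates) is a
    subcomodule iff it is stable under all (id ⊗ f)∘α, f ∈ A^*. *)
Definition irr_corep (A : algType C) (Delta : A -> seq (A * A)) (eps : A -> C)
    (n : nat) (u : 'M[A]_n) : Prop :=
  [/\ is_corep Delta eps u, (0 < n)%N
    & forall W : 'M[C]_n,
        (forall f : {scalar A}, (W *m (map_mx f u)^T <= W)%MS) ->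
        \rank W = 0%N \/ \rank W = n].

Definition corep_equiv (A : algType C) (n m : nat) (u : 'M[A]_n)
    (v : 'M[A]_m) : Prop :=
  exists T : 'M[C]_(m, n),
    [/\ m = n, \rank T = n
      & map_mx (in_alg A) T *m u = v *m map_mx (in_alg A) T].

Definition mx_star (A : algType C) (st : A -> A) (n : nat) (u : 'M[A]_n)
  : 'M[A]_n := \matrix_(i, j) st (u j i).

Definition free_family (V : lmodType C) (J : Type) (x : J -> V) : Prop :=
  forall (m : nat) (f : 'I_m -> J) (c : 'I_m -> C),
    injective f -> \sum_(k < m) c k *: x (f k) = 0 -> forall k, c k = 0.

Definition spanning_family (V : lmodType C) (J : Type) (x : J -> V) : Prop :=
  forall v : V, exists (m : nat) (f : 'I_m -> J) (c : 'I_m -> C),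
    v = \sum_(k < m) c k *: x (f k).

Definition basis_family (V : lmodType C) (J : Type) (x : J -> V) : Prop :=
  free_family x /\ spanning_family x.

(* Main.v *)
Require Import Defs.
From HB Require Import structures.
From mathcomp Require Import all_boot all_order all_algebra.
From mathcomp Require Import complex Rstruct.
From mathcomp Require Import boolp classical_sets.
Import Order.TTheory GRing.Theory Num.Theory.
Local Open Scope ring_scope.

Set Implicit Arguments. Unset Strict Implicit. Unset Printing Implicit Defensive.

(* Finite sums of elementary tensors are compared through pairs of functionals,
   and functionals separate points (Zorn), so every comodule argument becomes a
   statement about the matrices f(u) for f in the dual of A.

   For A: each x lies in the finite-dimensional subcomodule of its translates,
   invariant scalar products split corepresentations, and Jacobson density for
   the irreducible ones gives functionals dual to the coefficients a^l_ij.

   For Z: let W be the space of columns w with alpha(w_i) = sum_k a^l_ik (x) w_k.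
   Expanding alpha in the basis a^l_ij shows that Z is spanned by the entries of
   such columns. Surjectivity of the Galois map gives a matrix w of elements of W
   with a right inverse y; injectivity gives v (x) 1 = sum_j w_j (x) (y v)_j for v
   in W, so W is spanned by the finitely many w_j. For a basis z of W the entries of z^* z
   are coinvariant, hence scalar, and form a positive semidefinite matrix by
   positivity of mu; z y = 1 makes it definite. Orthonormalizing gives z^* z = 1,
   and then z^* = z^* z y = y. *)

(** * Subspaces as predicates, and separation of points by functionals *)

Definition subspace (V : lmodType C) (P : V -> Prop) : Prop :=
  P 0 /\ forall (c : C) x y, P x -> P y -> P (c *: x + y).

Section Subspace.
Variables (V : lmodType C) (P : V -> Prop).
Hypothesis sP : subspace P.

Lemma subspaceZ c x : P x -> P (c *: x).
Proof. by move=> Px; rewrite -[_ *: _]addr0; apply: sP.2 => //; apply: sP.1. Qed.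

Lemma subspaceD x y : P x -> P y -> P (x + y).
Proof. by move=> Px Py; rewrite -[x]scale1r; apply: sP.2. Qed.

Lemma subspaceB x y : P x -> P y -> P (x - y).
Proof. by move=> Px Py; rewrite addrC -scaleN1r; apply: sP.2. Qed.

Lemma subspace_sum (J : Type) (s : seq J) (Q : pred J) (F : J -> V) :
  (forall j, Q j -> P (F j)) -> P (\sum_(j <- s | Q j) F j).
Proof. by move=> PF; apply: big_ind => //; [apply: sP.1 | apply: subspaceD]. Qed.

End Subspace.

Lemma mk_scalar (V : lmodType C) (f : V -> C) :
  (forall c x y, f (c *: x + y) = c * f x + f y) -> {F : {scalar V} | F =1 f}.
Proof.
move=> fL.
pose F : {scalar V} := HB.pack f (GRing.isLinear.Build C V C *%R f fL).
by exists F.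
Qed.

Section Separation.
Local Open Scope classical_set_scope.
Variables (V : lmodType C) (M : V -> Prop) (v : V).
Hypotheses (sM : subspace M) (nMv : ~ M v).

(** Zorn's lemma gives [X] maximal among the subspaces that contain [M] and avoid [v]. Enlarging [X]
    by any further vector must capture [v], so [X] is a hyperplane complementary to the line of
    [v]. *)
Lemma maximal_subspace : exists X : V -> Prop,
  [/\ subspace X, forall x, M x -> X x, ~ X v
    & forall x, exists c, X (x - c *: v)].
Proof.
pose good (X : set V) := [/\ subspace X, M `<=` X & ~ X v].
have [F FP Ftot | X [PX Xmax]] := @Zorn_bigcup V (fun X => X = set0 \/ good X).
  have [[X0 FX0 gX0] | noX] := pselect (exists2 X, F X & good X); last first.
    left; apply/seteqP; split=> // x [X FX Xx].
    by have [X0 | gX] := FP _ FX; [rewrite X0 in Xx | case: noX; exists X].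
  right; split.
  - split; first by exists X0 => //; case: gX0 => [[]].
    move=> c x y [X1 FX1 X1x] [X2 FX2 X2y].
    have [s12 | s21] := Ftot _ _ FX1 FX2.
      have [e | [[_ h] _ _]] := FP _ FX2; first by rewrite e in X2y.
      by exists X2 => //; apply: h => //; apply: s12.
    have [e | [[_ h] _ _]] := FP _ FX1; first by rewrite e in X1x.
    by exists X1 => //; apply: h => //; apply: s21.
  - by move=> x Mx; exists X0 => //; case: gX0 => _ + _; apply.
  - move=> [X FX Xv]; have [e | [_ _]] := FP _ FX; first by rewrite e in Xv.
    exact.
have {PX} [sX MX nXv] : good X.
  case: PX => // X0; exfalso; apply: (Xmax M); last by right; split.
  rewrite X0; split; first exact: sub0set.
  by move=> /(_ 0); apply; apply: sM.1.
exists X; split=> // x.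
have [Xx | nXx] := pselect (X x); first by exists 0; rewrite scale0r subr0.
(* [B] is spanned by [X] and [x], so maximality of [X] puts [v] in it. *)
pose B y := exists c, X (y - c *: x).
have sB : subspace B.
  split=> [|c y z [d Xd] [e Xe]]; first by exists 0; rewrite scale0r subr0; apply: sX.1.
  exists (c * d + e); have := sX.2 c _ _ Xd Xe.
  by rewrite scalerBr scalerDl opprD scalerA addrACA.
have XB : X `<=` B by move=> y Xy; exists 0; rewrite scale0r subr0.
have [Bv | nBv] := pselect (B v); last first.
  case: (Xmax B); last by right; split=> //; apply: subset_trans XB.
  split=> // /(_ x); apply: contra_not nXx => //; apply.
  by exists 1; rewrite scale1r subrr; apply: sX.1.
have [c Xc] := Bv; exists c^-1.
have c0 : c != 0 by apply: contra_not_neq nXv => c0; rewrite c0 scale0r subr0 in Xc.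
have := subspaceZ sX (- c^-1) Xc.
by rewrite scalerBr !scaleNr opprK scalerA mulVf // scale1r addrC.
Qed.

(** The functional sends [x] to the unique [c] such that [x - c *: v] lies in the hyperplane [X]. *)
Lemma separating_functional :
  exists2 f : {scalar V}, f v = 1 & forall x, M x -> f x = 0.
Proof.
have [X [sX MX nXv /choice[f fX]]] := maximal_subspace.
have fU x c : X (x - c *: v) -> f x = c.
  move=> Xc; apply: contra_not_eq nXv => fc.
  have := subspaceB sX Xc (fX x).
  rewrite opprB addrC addrA subrK -scalerBl => /(subspaceZ sX (f x - c)^-1).
  by rewrite scalerA mulVf ?subr_eq0 // scale1r.
have fL c x y : f (c *: x + y) = c * f x + f y.
  apply: fU; have := sX.2 c _ _ (fX x) (fX y).
  by rewrite scalerBr scalerDl opprD scalerA addrACA.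
have [F FE] := mk_scalar fL.
exists F; rewrite ?FE; first by apply: fU; rewrite scale1r subrr; apply: sX.1.
by move=> x Mx; rewrite FE; apply: fU; rewrite scale0r subr0; apply: MX.
Qed.

End Separation.

Lemma functional_neq0 (V : lmodType C) (v : V) :
  v != 0 -> exists f : {scalar V}, f v = 1.
Proof.
move=> v0; have [||f fv _] := @separating_functional V (fun x => x = 0) v.
- by split=> // c x y -> ->; rewrite scaler0 addr0.
- by move=> v00; rewrite v00 eqxx in v0.
by exists f.
Qed.

Lemma functional_ext (V : lmodType C) (x y : V) :
  (forall f : {scalar V}, f x = f y) -> x = y.
Proof.
move=> fxy; apply/eqP; rewrite -subr_eq0; apply: contraT => /functional_neq0[f].
by rewrite raddfB /= fxy subrr => /eqP; rewrite eq_sym oner_eq0.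
Qed.

(** Vectors of [s] are added one at a time, keeping the part independent of the earlier ones. The
    last clause says that the [e i] lie in the span of [s], so they inherit every linear property
    shared by its members. *)
Lemma finite_dual_basis (V : lmodType C) (s : seq V) :
  exists (m : nat) (e : 'I_m -> V) (g : 'I_m -> {scalar V}),
    [/\ forall i j, g i (e j) = (i == j)%:R,
        {in s, forall x, x = \sum_i g i x *: e i}
      & forall P : V -> Prop, subspace P -> {in s, forall x, P x} ->
          forall i, P (e i)].
Proof.
elim: s => [|x s [m [e [g [ge gs eP]]]]].
  have [z _] : {F : {scalar V} | F =1 fun=> 0}.
    by apply: mk_scalar => *; rewrite mulr0 addr0.
  exists 0%N, (fun=> 0), (fun=> z).
  by split=> [[]|x|P _ _ []].
pose r := x - \sum_i g i x *: e i.
have gr i : g i r = 0.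
  rewrite raddfB raddf_sum /= (bigD1 i) //= big1 ?addr0 => [|j ji].
    by rewrite linearZ /= ge eqxx mulr1 subrr.
  by rewrite linearZ /= ge eq_sym (negPf ji) mulr0.
have [r0 | r0] := eqVneq r 0.
  exists m, e, g; split=> // [y | P sP sPx i].
    rewrite inE => /predU1P[-> | /gs //].
    by apply/eqP; rewrite -subr_eq0; apply/eqP.
  by apply: eP => // y ys; apply: sPx; rewrite inE ys orbT.
have [h hr] := functional_neq0 r0.
(* The correction makes the new functional vanish on the old [e i]; its value at [r] stays 1 because
   every [g i] kills [r]. *)
have [h' h'E] : {F : {scalar V} | F =1 fun y => h y - \sum_i h (e i) * g i y}.
  apply: mk_scalar => c y z; rewrite !linearP /= !mulrBr addrACA -opprD; congr (_ - _).
  rewrite mulr_sumr -big_split; apply: eq_bigr => i _ /=.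
  by rewrite linearP /= mulrDr mulrCA.
have h'e i : h' (e i) = 0.
  rewrite h'E (bigD1 i) //= ge eqxx mulr1 big1 ?addr0 ?subrr // => j ji.
  by rewrite ge (negPf ji) mulr0.
have h'r : h' r = 1.
  by rewrite h'E hr big1 ?subr0 // => i _; rewrite gr mulr0.
exists m.+1, (fun i => if unlift ord0 i is Some j then e j else r).
exists (fun i => if unlift ord0 i is Some j then g j else h'); split.
- move=> i j; case: unliftP => [i' ->|->]; case: unliftP => [j' ->|->].
  + by rewrite ge (inj_eq lift_inj).
  + by rewrite gr eq_sym (negPf (neq_lift _ _)).
  + by rewrite h'e (negPf (neq_lift _ _)).
  + by rewrite h'r eqxx.
- have big0 y : \sum_(i < m.+1) (if unlift ord0 i is Some j then g j else h') y
      *: (if unlift ord0 i is Some j then e j else r)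
      = h' y *: r + \sum_i g i y *: e i.
    rewrite big_ord_recl unlift_none; congr (_ + _); apply: eq_bigr => i _.
    by rewrite liftK.
  move=> y; rewrite big0 inE => /predU1P[-> | ys].
    suff -> : h' x = 1 by rewrite scale1r subrK.
    have -> : h' x = h' r + h' (\sum_i g i x *: e i) by rewrite -raddfD subrK.
    by rewrite h'r raddf_sum big1 ?addr0 // => i _ /=; rewrite linearZ /= h'e mulr0.
  rewrite {2}(gs _ ys) raddf_sum big1 ?scale0r ?add0r; first exact: gs.
  by move=> i _ /=; rewrite linearZ /= h'e mulr0.
- move=> P sP Px i; have Pe j : P (e j).
    by apply: eP => // y ys; apply: Px; rewrite inE ys orbT.
  case: unlift => // ; apply: subspaceB => //; first by apply: Px; rewrite mem_head.
  by apply: subspace_sum => // j _; apply: subspaceZ.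
Qed.

(** * Tensors compared through functionals *)

Lemma teq_l (U V : lmodType C) (s t : seq (U * V)) :
  teq s t <-> forall f : {scalar U},
    \sum_(p <- s) f p.1 *: p.2 = \sum_(p <- t) f p.1 *: p.2.
Proof.
have sumE (f : {scalar U}) (g : {scalar V}) (r : seq (U * V)) :
    g (\sum_(p <- r) f p.1 *: p.2) = \sum_(p <- r) f p.1 * g p.2.
  by rewrite raddf_sum; apply: eq_bigr => p _ /=; rewrite linearZ.
split=> [st f | st f g]; last by rewrite -!sumE st.
by apply: functional_ext => g; rewrite !sumE; apply: st.
Qed.

(** Bilinear maps descend to tensors: once the first factors are expanded in a finite dual basis,
    both sums depend only on the slices in [V]. *)
Lemma teq_bilinear (U V W : lmodType C) (s t : seq (U * V)) (B : U -> V -> W) :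
  (forall c x y v, B (c *: x + y) v = c *: B x v + B y v) ->
  (forall c u x y, B u (c *: x + y) = c *: B u x + B u y) ->
  teq s t -> \sum_(p <- s) B p.1 p.2 = \sum_(p <- t) B p.1 p.2.
Proof.
move=> BL BR /teq_l st.
have [m [e [g [_ gs _]]]] := finite_dual_basis [seq p.1 | p <- s ++ t].
have BL0 v : B 0 v = 0.
  by apply: (addIr (B 0 v)); rewrite add0r -{1}[B 0 v]scale1r -BL scale1r addr0.
have BR0 u : B u 0 = 0.
  by apply: (addIr (B u 0)); rewrite add0r -{1}[B u 0]scale1r -BR scale1r addr0.
have BLsum (F : 'I_m -> C) v : B (\sum_i F i *: e i) v = \sum_i F i *: B (e i) v.
  by elim/big_rec2: _ => [|i x y _ <-]; rewrite ?BL0 ?BL.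
have sumE (r : seq (U * V)) : {subset r <= s ++ t} ->
    \sum_(p <- r) B p.1 p.2 = \sum_i B (e i) (\sum_(p <- r) g i p.1 *: p.2).
  move=> rst; transitivity (\sum_(p <- r) \sum_i g i p.1 *: B (e i) p.2).
    rewrite !big_seq; apply: eq_bigr => p pr; rewrite -BLsum -gs //.
    by apply: map_f; apply: rst.
  rewrite exchange_big; apply: eq_bigr => i _ /=.
  by elim/big_rec2: _ => [|p x y _ ->]; rewrite ?BR0 ?BR.
rewrite !sumE; first by apply: eq_bigr => i _; rewrite st.
  by move=> p pt; rewrite mem_cat pt orbT.
by move=> p ps; rewrite mem_cat ps.
Qed.

(** * Hermitian forms and subspaces of row vectors *)

Definition ctrmx (m n : nat) (Q : 'M[C]_(m, n)) : 'M[C]_(n, m) :=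
  (map_mx Num.conj Q)^T.

Lemma ctrmxM m n p (P : 'M[C]_(m, n)) (Q : 'M[C]_(n, p)) :
  ctrmx (P *m Q) = ctrmx Q *m ctrmx P.
Proof. by rewrite /ctrmx map_mxM trmx_mul. Qed.

Lemma ctrmx1 n : ctrmx 1%:M = 1%:M :> 'M[C]_n.
Proof. by rewrite /ctrmx map_mx1 trmx1. Qed.

Lemma hermitian_diagonalization (n : nat) (H : 'M[C]_n) :
  (forall i j, H j i = (H i j)^*) ->
  exists Q D, Q \in unitmx /\ ctrmx Q *m H *m Q = diag_mx D.
Proof.
move=> Hherm.
have /hermitian_normalmx/orthomx_spectralP HE : H \is hermsymmx.
  by apply/is_hermitianmxP/matrixP => i j; rewrite expr0 scale1r !mxE Hherm.
have Pun := spectral_unit H; have Puni := spectral_unitarymx H.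
exists (invmx (spectralmx H)), (spectral_diag H); split; first by rewrite unitmx_inv.
have -> : ctrmx (invmx (spectralmx H)) = spectralmx H.
  by apply/matrixP => i j; rewrite invmx_unitary // !mxE conjCK.
by rewrite {2}HE mulmxA mulmxK // mulmxA mulmxV // mul1mx.
Qed.

(** Columns of a diagonalizing matrix are rescaled by inverse square roots. Positivity is asked of
    all diagonal forms of [H] because its two uses establish it differently: from an invariant
    scalar product and from the Haar measure. *)
Lemma hermitian_orthonormalization (n : nat) (H : 'M[C]_n) :
  (forall i j, H j i = (H i j)^*) ->
  (forall Q D, Q \in unitmx -> ctrmx Q *m H *m Q = diag_mx D ->
     forall j, 0 < D 0 j) ->
  exists2 Q, Q \in unitmx & ctrmx Q *m H *m Q = 1%:M.
Proof.
move=> Hherm Dpos; have [Q [D [Qu QH]]] := hermitian_diagonalization Hherm.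
have D0 j : 0 < D 0 j by apply: Dpos Qu QH j.
pose R := diag_mx (\row_j (sqrtC (D 0 j))^-1).
have s0 j : sqrtC (D 0 j) != 0 by rewrite sqrtC_eq0 gt_eqF.
have Ru : R \in unitmx.
  rewrite unitmxE det_diag unitfE; apply/prodf_neq0 => i _.
  by rewrite mxE invr_eq0.
exists (Q *m R); first by rewrite unitmx_mul Qu.
rewrite ctrmxM !mulmxA -(mulmxA _ _ H) -(mulmxA _ _ Q) QH.
have -> : ctrmx R = R.
  apply/matrixP => i j; rewrite !mxE rmorphMn /= eq_sym; case: eqP => [->|] //.
  by rewrite geC0_conj // invr_ge0 sqrtC_ge0 ltW.
rewrite !mulmx_diag; apply/matrixP => i j.
rewrite !mxE; case: eqP => [->|_]; last by rewrite !mulr0n.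
rewrite !mulr1n -{2}[D 0 j]sqrtCK.
by rewrite expr2 mulrA mulVf // mul1r mulfV.
Qed.

(** Take [W] of maximal rank among the matrices whose row space is contained in [P]. *)
Lemma subspace_mx (n : nat) (P : 'rV[C]_n -> Prop) :
  subspace P -> exists W : 'M[C]_n, forall w, (w <= W)%MS <-> P w.
Proof.
move=> sP.
pose ok r := `[< exists2 W : 'M[C]_n, \rank W = r & forall w : 'rV_n, (w <= W)%MS -> P w >].
have ok0 : exists r, ok r.
  exists 0%N; apply/asboolP; exists 0; first exact: mxrank0.
  by move=> w; rewrite submx0 => /eqP ->; apply: sP.1.
have okn r : ok r -> (r <= n)%N by move=> /asboolP[W <- _]; apply: rank_leq_col.
case: (ex_maxnP ok0 okn) => r /asboolP[W rW WP] rmax.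
exists W => w; split=> [/WP //|Pw].
have ok1 : ok (\rank (W + w)%MS).
  apply/asboolP; exists (W + w)%MS => // x /sub_addsmxP[[x1 x2] /= ->].
  apply: subspaceD => //; first by apply: WP; apply: submxMl.
  by rewrite (mx11_scalar x2) mul_scalar_mx; apply: subspaceZ.
have := rmax _ ok1; rewrite -rW => rWw.
have /mxrank_leqif_sup[_ e] : (W <= W + w)%MS by apply: addsmxSl.
rewrite eqn_leq rWw andbT mxrankS ?addsmxSl // in e.
by apply: submx_trans (_ : W + w <= W)%MS; rewrite ?addsmxSr // -e.
Qed.

(** * The convolution algebra of functionals and finiteness of comodules *)

Section Coalgebra.
Variables (A : algType C) (Delta : A -> seq (A * A)) (eps : A -> C).
Hypothesis DeltaL : tlinear Delta.
Hypothesis DeltaA : forall x,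
  teq3 [seq ((q.1, q.2), p.2) | p <- Delta x, q <- Delta p.1]
       [seq ((p.1, q.1), q.2) | p <- Delta x, q <- Delta p.2].
Hypothesis epsL : forall (c : C) x y, eps (c *: x + y) = c * eps x + eps y.
Hypothesis counitl : forall x, \sum_(p <- Delta x) eps p.1 *: p.2 = x.
Hypothesis counitr : forall x, \sum_(p <- Delta x) eps p.2 *: p.1 = x.

Lemma tlinear_scalar (U V W : lmodType C) (d : U -> seq (V * W)) :
  tlinear d -> forall (f : {scalar V}) (g : {scalar W}) c x y,
  \sum_(p <- d (c *: x + y)) f p.1 * g p.2
  = c * (\sum_(p <- d x) f p.1 * g p.2) + \sum_(p <- d y) f p.1 * g p.2.
Proof.
move=> dL f g c x y; rewrite (dL c x y f g) big_cat /= big_map mulr_sumr.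
by congr (_ + _); apply: eq_bigr => p _; rewrite /= linearZ /= mulrA.
Qed.

Definition conv (f g : {scalar A}) : {scalar A} :=
  sval (mk_scalar (tlinear_scalar DeltaL f g)).

Lemma convE f g x : conv f g x = \sum_(p <- Delta x) f p.1 * g p.2.
Proof. exact: (svalP (mk_scalar (tlinear_scalar DeltaL f g))). Qed.

Definition counit : {scalar A} := sval (mk_scalar epsL).

Lemma counitE x : counit x = eps x.
Proof. exact: (svalP (mk_scalar epsL)). Qed.

(** The slice of the coproduct by [f] in the second factor; by coassociativity this is a left action
    of the convolution algebra on [A]. *)
Definition rtrans (f : {scalar A}) (x : A) : A := \sum_(p <- Delta x) f p.2 *: p.1.

Lemma scalar_rtrans (h f : {scalar A}) x : h (rtrans f x) = conv h f x.
Proof.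
rewrite convE raddf_sum; apply: eq_bigr => p _.
by rewrite /= linearZ /= mulrC.
Qed.

Lemma rtransP f c x y : rtrans f (c *: x + y) = c *: rtrans f x + rtrans f y.
Proof.
by apply: functional_ext => h; rewrite linearP !scalar_rtrans linearP.
Qed.

Lemma rtrans_sum f (J : Type) (s : seq J) (c : J -> C) (F : J -> A) :
  rtrans f (\sum_(j <- s) c j *: F j) = \sum_(j <- s) c j *: rtrans f (F j).
Proof.
have r0 : rtrans f 0 = 0.
  by apply: functional_ext => h; rewrite scalar_rtrans !raddf0.
by elim/big_rec2: _ => [|j x y _ <-]; rewrite ?r0 ?rtransP.
Qed.

Lemma rtrans_conv f g x : rtrans f (rtrans g x) = rtrans (conv f g) x.
Proof.
apply: functional_ext => h; rewrite [RHS]scalar_rtrans [RHS]convE.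
rewrite [rtrans g x]/rtrans rtrans_sum raddf_sum /=.
have := DeltaA x h f g; rewrite !big_allpairs_dep /= => E.
transitivity (\sum_(p <- Delta x) \sum_(q <- Delta p.1) h q.1 * f q.2 * g p.2).
  apply: eq_bigr => p _; rewrite linearZ /= scalar_rtrans convE mulr_sumr.
  by apply: eq_bigr => q _; rewrite mulrC.
rewrite E; apply: eq_bigr => p _; rewrite convE mulr_sumr.
by apply: eq_bigr => q _; rewrite mulrA.
Qed.

Lemma rtrans_counit x : rtrans counit x = x.
Proof.
by rewrite -[RHS]counitr; apply: eq_bigr => p _; rewrite counitE.
Qed.

Lemma conv_counitl f x : conv counit f x = f x.
Proof.
rewrite convE -[in RHS](counitl x) raddf_sum; apply: eq_bigr => p _.
by rewrite /= linearZ /= counitE.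
Qed.

(** Seen through functionals, a corepresentation is a unital representation of the convolution
    algebra by complex matrices. *)
Lemma corepP n (u : 'M[A]_n) :
  is_corep Delta eps u <->
  (forall f g, map_mx (conv f g) u = map_mx f u *m map_mx g u) /\
  map_mx eps u = 1%:M.
Proof.
split=> [[uD ue] | [uD ue]].
  split=> [f g|]; last by apply/matrixP => i j; rewrite !mxE ue.
  apply/matrixP => i j; rewrite !mxE convE (uD i j f g) big_map big_enum /=.
  by apply: eq_bigr => k _; rewrite !mxE.
split=> [i j f g | i j]; last by have /matrixP/(_ i j) := ue; rewrite !mxE.
have /matrixP/(_ i j) := uD f g; rewrite !mxE convE => ->.
by rewrite big_map big_enum; apply: eq_bigr => k _; rewrite !mxE.
Qed.

(* The translates of [x] span a finite-dimensional subcomodule containing [x]. *)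
Lemma mem_coefficients x : exists n (u : 'M[A]_n) (c : 'M[C]_n),
  is_corep Delta eps u /\ x = \sum_i \sum_j c i j *: u i j.
Proof.
pose orbit v := exists f, v = rtrans f x.
have sorbit : subspace orbit.
  split=> [|c _ _ [f ->] [g ->]].
    have [f fE] : {F : {scalar A} | F =1 fun=> 0}.
      by apply: mk_scalar => *; rewrite mulr0 addr0.
    by exists f; rewrite /rtrans big1 // => p _; rewrite fE scale0r.
  have [h hE] : {F : {scalar A} | F =1 fun y => c * f y + g y}.
    by apply: mk_scalar => d y z; rewrite !linearP /= !mulrDr addrACA mulrCA.
  exists h; rewrite /rtrans scaler_sumr -big_split; apply: eq_bigr => p _.
  by rewrite hE scalerDl scalerA.
(* Only the second factors of [Delta x] matter, so finitely many translates span the orbit; [e'] is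
   then a basis of it. *)
have [m [e [g [_ gs _]]]] := finite_dual_basis [seq p.2 | p <- Delta x].
have [n [e' [g' [ge' gs' eP']]]] :=
  finite_dual_basis [seq rtrans (g i) x | i <- enum 'I_m].
have gorbit v : orbit v -> v = \sum_k g' k v *: e' k.
  move=> [f ->].
  have -> : rtrans f x = \sum_i f (e i) *: rtrans (g i) x.
    under eq_bigr do rewrite scaler_sumr; rewrite exchange_big /rtrans big_seq.
    rewrite [RHS]big_seq; apply: eq_bigr => p pD; rewrite {1}(gs p.2) ?map_f //.
    rewrite raddf_sum scaler_suml; apply: eq_bigr => i _ /=.
    by rewrite linearZ /= mulrC scalerA.
  transitivity (\sum_i f (e i) *: \sum_k g' k (rtrans (g i) x) *: e' k).
    apply: eq_bigr => i _; congr (_ *: _); apply: gs'.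
    by apply: map_f; rewrite mem_enum.
  under eq_bigr do rewrite scaler_sumr; rewrite exchange_big.
  apply: eq_bigr => k _; rewrite raddf_sum scaler_suml; apply: eq_bigr => i _ /=.
  by rewrite scalerA [in RHS]linearZ.
have orbit_e' j : orbit (e' j).
  by apply: eP' => // _ /mapP[i _ ->]; exists (g i).
(* Matrix of the coaction in the basis [e']: the coproduct of [e' j] is the sum of the
   [e' k ⊗ u k j]. *)
pose u := \matrix_(k, j) \sum_(p <- Delta (e' j)) g' k p.1 *: p.2.
have fu (f : {scalar A}) k j : f (u k j) = g' k (rtrans f (e' j)).
  rewrite mxE scalar_rtrans convE raddf_sum; apply: eq_bigr => p _ /=.
  by rewrite linearZ.
have rte f j : rtrans f (e' j) = \sum_k f (u k j) *: e' k.
  under eq_bigr do rewrite fu; apply: gorbit.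
  by have [h ->] := orbit_e' j; exists (conv f h); rewrite rtrans_conv.
have xorb : orbit x by exists counit; rewrite rtrans_counit.
(* The coefficients come from [x = sum_j g' j x *: e' j] and, applying the counit to the first
   factor, [e' j = sum_i eps (e' i) *: u i j]. *)
exists n, u, (\matrix_(i, j) (g' j x * eps (e' i))); split.
  apply/corepP; split=> [f h|]; apply/matrixP => k j; rewrite [LHS]mxE [RHS]mxE; last first.
    by rewrite -counitE fu rtrans_counit ge'.
  rewrite fu -rtrans_conv rte rtrans_sum raddf_sum; apply: eq_bigr => l _ /=.
  by rewrite linearZ /= -fu mulrC; congr (_ * _); rewrite [RHS]mxE.
rewrite {1}(gorbit x xorb) exchange_big; apply: eq_bigr => j _ /=.
under eq_bigr do rewrite mxE -scalerA; rewrite -scaler_sumr; congr (_ *: _).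
apply: functional_ext => f; rewrite -[LHS]conv_counitl -scalar_rtrans rte.
rewrite !raddf_sum; apply: eq_bigr => k _ /=.
by rewrite !linearZ /= counitE mulrC.
Qed.

End Coalgebra.

(** * Matrices of functionals and Schur's lemma *)

Lemma map_scalar_mulmxl (A : algType C) m n p (f : {scalar A}) (T : 'M[C]_(m, n))
    (u : 'M[A]_(n, p)) : map_mx f (map_mx (in_alg A) T *m u) = T *m map_mx f u.
Proof.
apply/matrixP => i j; rewrite !mxE raddf_sum; apply: eq_bigr => k _ /=.
by rewrite !mxE mulr_algl linearZ.
Qed.

Lemma map_scalar_mulmxr (A : algType C) m n p (f : {scalar A}) (u : 'M[A]_(m, n))
    (T : 'M[C]_(n, p)) : map_mx f (u *m map_mx (in_alg A) T) = map_mx f u *m T.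
Proof.
apply/matrixP => i j; rewrite !mxE raddf_sum; apply: eq_bigr => k _ /=.
by rewrite !mxE mulr_algr linearZ /= mulrC.
Qed.

Lemma map_scalar_inj (V : lmodType C) m n (u v : 'M[V]_(m, n)) :
  (forall f : {scalar V}, map_mx f u = map_mx f v) -> u = v.
Proof.
move=> uv; apply/matrixP => i j; apply: functional_ext => f.
by have /matrixP/(_ i j) := uv f; rewrite !mxE.
Qed.

Section Schur.
Variables (A : algType C) (Delta : A -> seq (A * A)) (eps : A -> C).

Lemma irr_stable n (u : 'M[A]_n) (P : 'rV[C]_n -> Prop) :
  irr_corep Delta eps u -> subspace P ->
  (forall (f : {scalar A}) w, P w -> P (w *m (map_mx f u)^T)) ->
  forall w0, P w0 -> w0 != 0 -> forall w, P w.
Proof.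
move=> [_ _ uirr] sP Pst w0 Pw0 w00 w; have [W WP] := subspace_mx sP.
have [f| /eqP | rW] := uirr W.
- apply/row_subP => i; rewrite row_mul; apply/WP/Pst/WP; exact: row_sub.
- rewrite mxrank_eq0 => /eqP W0; have /WP := Pw0.
  by rewrite W0 submx0 (negPf w00).
- by apply/WP/submx_full; rewrite /row_full rW.
Qed.

(** The row space of [X] is stable for [a0] and its left kernel for [a1], so [X] is zero or
    invertible, in which case [X^T] is the equivalence. *)
Lemma schur n1 n0 (a1 : 'M[A]_n1) (a0 : 'M[A]_n0) (X : 'M[C]_(n1, n0)) :
  irr_corep Delta eps a1 -> irr_corep Delta eps a0 ->
  (forall f : {scalar A}, (map_mx f a1)^T *m X = X *m (map_mx f a0)^T) ->
  X = 0 \/ corep_equiv a1 a0.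
Proof.
move=> [_ _ irr1] [_ _ irr0] aX.
have [|/eqP|rX] := irr0 <<X>>%MS; first move=> f.
- rewrite !genmxE (eqmxMr _ (genmxE X)) -aX; exact: submxMl.
- by rewrite mxrank_gen mxrank_eq0 => /eqP; left.
rewrite mxrank_gen in rX.
have [|rK|rK] := irr1 (kermx X); first move=> f.
- by apply/sub_kermxP; rewrite -mulmxA aX mulmxA mulmx_ker mul0mx.
- right; have rX1 : \rank X = n1.
    apply/eqP; rewrite eqn_leq rank_leq_row -subn_eq0 -mxrank_ker.
    by rewrite rK.
  exists X^T; split; [by rewrite -rX rX1 | by rewrite mxrank_tr |].
  apply: map_scalar_inj => f; rewrite map_scalar_mulmxl map_scalar_mulmxr.
  by apply: trmx_inj; rewrite !trmx_mul trmxK aX.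
- left; apply/eqP; rewrite -mxrank_eq0 -leqn0.
  have := mxrank_ker X; rewrite rK => e.
  by rewrite -(subKn (rank_leq_row X)) -e subnn.
Qed.

(** [X] has an eigenvalue [d]; the left kernel of [X - d] is stable and nonzero, hence
    everything. *)
Lemma schur_scalar n (a : 'M[A]_n) (X : 'M[C]_n) :
  irr_corep Delta eps a ->
  (forall f : {scalar A}, (map_mx f a)^T *m X = X *m (map_mx f a)^T) ->
  exists d : C, X = d%:M.
Proof.
move=> airr aX; have [_ n0 _] := airr.
have [d /eigenvalueP[v vX v0]] := eigenvalue_closed X n0; exists d.
pose P (w : 'rV[C]_n) := w *m (X - d%:M) = 0.
have Pall : forall w, P w.
  apply: (irr_stable airr _ _ (w0 := v)) => //.
  - split=> [|c x y]; rewrite /P ?mul0mx // mulmxDl -scalemxAl => -> ->.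
    by rewrite scaler0 addr0.
  - move=> f w Pw; rewrite /P -mulmxA mulmxBr aX scalar_mxC -mulmxBl.
    by rewrite mulmxA [w *m _]Pw mul0mx.
  - by rewrite /P mulmxBr vX mul_mx_scalar subrr.
by apply/eqP; rewrite -subr_eq0; apply/eqP/row_matrixP => i; rewrite rowE Pall row0.
Qed.

End Schur.

(** * Jacobson density and functionals dual to the coefficients *)

Section Density.
Variables (A : algType C) (Delta : A -> seq (A * A)) (eps : A -> C).
Hypothesis DeltaL : tlinear Delta.
Hypothesis epsL : forall (c : C) x y, eps (c *: x + y) = c * eps x + eps y.
Variables (I : eqType) (n : I -> nat) (a : forall l, 'M[A]_(n l)).
Hypothesis airr : forall l, irr_corep Delta eps (a l).
Hypothesis aneq : forall l l', l <> l' -> ~ corep_equiv (a l) (a l').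

(** Tagged vectors allow one list to mix vectors of different simple modules. *)
Definition kills (g : {scalar A}) (x : {l : I & 'rV[C]_(n l)}) : Prop :=
  tagged x *m (map_mx g (a (tag x)))^T = 0.

Lemma map_conv l f g :
  (map_mx (conv DeltaL f g) (a l))^T = (map_mx g (a l))^T *m (map_mx f (a l))^T.
Proof.
have [/(corepP eps DeltaL)[aD _] _ _] := airr l.
by rewrite aD trmx_mul.
Qed.

Lemma kills_conv f g x : kills g x -> kills (conv DeltaL f g) x.
Proof. by rewrite /kills map_conv mulmxA => ->; rewrite mul0mx. Qed.

Section Annihilator.
Variables (L : seq {l : I & 'rV[C]_(n l)}).

Definition kills_all (g : {scalar A}) := {in L, forall x, kills g x}.

(** The functionals killing [L] form a left ideal, so the images of [w1] under them form a stable
    subspace. Irreducibility makes it everything once it is nonzero. *)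
Lemma orbit_full l1 (w1 : 'rV[C]_(n l1)) g1 :
  kills_all g1 -> w1 *m (map_mx g1 (a l1))^T != 0 ->
  forall w, exists2 g, kills_all g & w1 *m (map_mx g (a l1))^T = w.
Proof.
move=> Lg1 wg1; apply: (irr_stable (airr l1) _ _ _ wg1); last by exists g1.
- split=> [|c _ _ [f Lf <-] [g Lg <-]].
    have [f fE] : {F : {scalar A} | F =1 fun=> 0}.
      by apply: mk_scalar => *; rewrite mulr0 addr0.
    have f0 l : map_mx f (a l) = 0 by apply/matrixP => i j; rewrite !mxE fE.
    by exists f => [x _|]; rewrite /kills f0 trmx0 mulmx0.
  have [h hE] : {F : {scalar A} | F =1 fun y => c * f y + g y}.
    by apply: mk_scalar => d y z; rewrite !linearP /= !mulrDr addrACA mulrCA.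
  have hl l : (map_mx h (a l))^T = c *: (map_mx f (a l))^T + (map_mx g (a l))^T.
    by apply/matrixP => i j; rewrite !mxE hE.
  exists h => [x xL|]; rewrite /kills hl mulmxDr -scalemxAr //.
  by rewrite [tagged x *m _]Lf // [tagged x *m _]Lg // scaler0 addr0.
- move=> f _ [g Lg <-]; exists (conv DeltaL f g); last by rewrite map_conv mulmxA.
  by move=> x xL; apply/kills_conv/Lg.
Qed.

End Annihilator.

(* Jacobson's density theorem for the pairwise inequivalent simple modules
   given by the [a l] over the convolution algebra of functionals on [A]. *)
Lemma density (L : seq {l : I & 'rV[C]_(n l)}) l0 (w0 : 'rV[C]_(n l0)) :
  (forall g, kills_all L g -> kills g (Tagged (fun l => 'rV[C]_(n l)) w0)) ->
  forall P : 'rV[C]_(n l0) -> Prop, subspace P ->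
    (forall w, Tagged (fun l => 'rV[C]_(n l)) w \in L -> P w) -> P w0.
Proof.
(* For the empty list, the counit acts as the identity and forces [w0 = 0]. *)
elim: L l0 w0 => [|[l1 w1] L IHL] l0 w0 Lw0 P sP PL.
  have := Lw0 (counit epsL); rewrite /kills /=.
  have [/(corepP eps DeltaL)[_ ae] _ _] := airr l0.
  rewrite (_ : map_mx _ _ = 1%:M); last first.
    by rewrite -ae; apply/matrixP => i j; rewrite !mxE counitE.
  by rewrite trmx1 mulmx1 => -> //; apply: sP.1.
set x1 := existT _ l1 w1 in Lw0 PL.
have [Lx1 | ] := pselect (forall g, kills_all L g -> kills g x1).
  apply: (IHL l0 w0) => // [g Lg | w wL]; last by apply: PL; rewrite inE wL orbT.
  apply: Lw0 => x; rewrite inE => /predU1P[-> | /Lg //]; exact: Lx1.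
move=> /existsNP[g1 /not_implyP[Lg1 /eqP x1g1]].
have full := orbit_full Lg1 x1g1.
have /choice[g gP] (i : 'I_(n l1)) : exists g, kills_all L g /\
    w1 *m (map_mx g (a l1))^T = delta_mx 0 i.
  by have [g Lg gE] := full (delta_mx 0 i); exists g.
(* [X] is the matrix of the map sending the image of [w1] under [h] to the image of [w0] under [h],
   for [h] killing [L]; its rows are its values on the standard basis. *)
pose X := \matrix_i (w0 *m (map_mx (g i) (a l0))^T).
have XP h : kills_all L h ->
    w0 *m (map_mx h (a l0))^T = w1 *m (map_mx h (a l1))^T *m X.
  move=> Lh; set y := _ *m (map_mx h (a l1))^T.
  (* Subtracting the [g i] leaves a functional that kills [w1] as well as [L], hence [w0]. *)
  have [k kE] : {F : {scalar A} | F =1 fun z => h z - \sum_i y 0 i * g i z}.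
    apply: mk_scalar => d z t; rewrite !linearP /= mulrBr addrACA -opprD.
    congr (_ - _); rewrite mulr_sumr -big_split; apply: eq_bigr => i _ /=.
    by rewrite linearP /= mulrDr mulrCA.
  have kl l : (map_mx k (a l))^T =
      (map_mx h (a l))^T - \sum_i y 0 i *: (map_mx (g i) (a l))^T.
    apply/matrixP => i j; rewrite !mxE kE summxE; congr (_ - _).
    by apply: eq_bigr => s _; rewrite !mxE.
  have kw l (w : 'rV_(n l)) : w *m (map_mx k (a l))^T =
      w *m (map_mx h (a l))^T - \sum_i y 0 i *: (w *m (map_mx (g i) (a l))^T).
    rewrite kl mulmxBr mulmx_sumr; congr (_ - _).
    by apply: eq_bigr => i _; rewrite scalemxAr.
  have yX : \sum_i y 0 i *: (w0 *m (map_mx (g i) (a l0))^T) = y *m X.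
    by rewrite mulmx_sum_row; apply: eq_bigr => i _; rewrite rowK.
  apply/eqP; rewrite -subr_eq0 -yX -kw; apply/eqP; apply: (Lw0 k).
  move=> x; rewrite inE => /predU1P[-> | xL]; rewrite /kills kw.
    rewrite /= -/y (eq_bigr (fun i => y 0 i *: delta_mx 0 i)) => [|i _].
      by rewrite -row_sum_delta subrr.
    by rewrite (gP i).2.
  rewrite [tagged x *m _]Lh // sub0r big1 ?oppr0 // => i _.
  by rewrite [tagged x *m _](gP i).1 // scaler0.
have aX (f : {scalar A}) : (map_mx f (a l1))^T *m X = X *m (map_mx f (a l0))^T.
  apply/row_matrixP => i; rewrite !row_mul rowK -mulmxA -map_conv XP.
    by rewrite map_conv mulmxA (gP i).2 rowE.
  by move=> x xL; apply/kills_conv/(gP i).1.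
have PL' w : Tagged (fun l => 'rV[C]_(n l)) w \in L -> P w.
  by move=> wL; apply: PL; rewrite inE wL orbT.
(* If [X = 0], whatever kills [L] kills [w0]. Otherwise [l1 = l0] and [X] is a scalar [d], and
   whatever kills [L] kills [w0 - d *: w1]. The induction hypothesis applies in both cases. *)
have [X0 | aeq] := schur (airr l1) (airr l0) aX.
  by apply: (IHL _ w0) => // h Lh; rewrite /kills /= XP // X0 mulmx0.
have [l10 | /eqP l10] := eqVneq l1 l0; last by case: (aneq l10).
case: _ / l10 in w0 Lw0 P sP PL X XP aX aeq PL' *.
have [d Xd] := schur_scalar (airr l1) aX.
have : P (w0 - d *: w1).
  apply: (IHL _ (w0 - d *: w1)) => // h Lh.
  by rewrite /kills /= mulmxBl XP // Xd mul_mx_scalar scalemxAl subrr.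
have Pw1 : P w1 by apply: PL; rewrite inE eqxx.
by move=> /(subspaceD sP (subspaceZ sP d Pw1)); rewrite addrC subrK.
Qed.

Definition coef (x : {l : I & ('I_(n l) * 'I_(n l))%type}) : A :=
  a (projT1 x) (projT2 x).1 (projT2 x).2.

(** Acting by [g] on the basis row of index [k] yields column [k] of [g(a l)]. Density gives a
    functional killing the other columns met in [s] but not column [k0], and irreducibility then
    lets column [k0] take a prescribed value. *)
Lemma finite_dual_coef j0 (s : seq {l : I & ('I_(n l) * 'I_(n l))%type}) :
  j0 \notin s ->
  exists2 g : {scalar A}, g (coef j0) = 1 & {in s, forall j, g (coef j) = 0}.
Proof.
case: j0 => l0 [i0 k0] j0s.
pose col (j : {l : I & ('I_(n l) * 'I_(n l))%type}) :=
  Tagged (fun l => 'I_(n l)) (tagged j).2.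
pose vec (j : {l : I & ('I_(n l) * 'I_(n l))%type}) :=
  Tagged (fun l => 'rV[C]_(n l)) (delta_mx 0 (tagged j).2 : 'rV[C]_(n (tag j))).
pose j0 := Tagged (fun l => ('I_(n l) * 'I_(n l))%type) (i0, k0).
pose L := [seq vec j | j <- s & col j != col j0].
have [g1 Lg1 wg1] : exists2 g, kills_all L g & ~ kills g (vec j0).
  apply: contrapT => no.
  suff : (delta_mx 0 k0 : 'rV[C]_(n l0)) 0 k0 = 0.
    by rewrite mxE !eqxx => /eqP; rewrite oner_eq0.
  (* Coordinate [k0] vanishes on all rows of [L] with tag [l0], but not on the basis row of index
     [k0]. *)
  apply: (@density L l0 (delta_mx 0 k0) _ (fun w => w 0 k0 = 0)).
  - by move=> g Lg; apply: contrapT => ng; apply: no; exists g.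
  - by split=> [|c x y]; rewrite !mxE // => -> ->; rewrite mulr0 addr0.
  - move=> w /mapP[[l [i k]]]; rewrite mem_filter => /andP[/= kk0 _] wE.
    have l0l : l0 = l by have /(congr1 tag) := wE.
    case: _ / l0l in i k kk0 wE *.
    have /eqP := wE; rewrite eq_Tagged /= => /eqP ->.
    by move: kk0; rewrite eq_Tagged /= mxE eqxx eq_sym => /negPf ->.
have [g Lg gE] := orbit_full Lg1 (introN eqP wg1) (delta_mx 0 i0).
have gk0 i : g (a l0 i k0) = (i == i0)%:R.
  by have /rowP/(_ i) := gE; rewrite -rowE !mxE => ->; rewrite eqxx.
exists g => [|[l [i k]] js]; first by rewrite /coef /= gk0 eqxx.
have [kk0 | kk0] := eqVneq (col (Tagged (fun l => ('I_(n l) * 'I_(n l))%type) (i, k))) (col j0).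
  have l0l : l0 = l by have /(congr1 tag) := kk0.
  case: _ / l0l in i k kk0 js *.
  move: kk0 => /eqP; rewrite eq_Tagged /= => /eqP kk0; rewrite kk0 in js *.
  rewrite /coef /= gk0; case: eqP => // ii0; by rewrite -ii0 js in j0s.
have /Lg : vec (Tagged (fun l => ('I_(n l) * 'I_(n l))%type) (i, k)) \in L.
  by apply: map_f; rewrite mem_filter kk0.
by rewrite /kills /= -rowE => /rowP/(_ i); rewrite !mxE.
Qed.

(** The finite case shows that no coefficient is in the span of the others; a separating functional
    then handles all of them at once. *)
Lemma dual_coef : exists G : {l : I & ('I_(n l) * 'I_(n l))%type} -> {scalar A},
  forall j j', G j (coef j') = (j == j')%:R.
Proof.
suff /choice[G GP] j : exists g : {scalar A}, forall j', g (coef j') = (j == j')%:R.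
  by exists G.
pose M x := exists2 s : seq (C * {l : I & ('I_(n l) * 'I_(n l))%type}),
  j \notin map snd s & x = \sum_(p <- s) p.1 *: coef p.2.
have [||g gj gM] := @separating_functional A M (coef j).
- split=> [|c _ _ [s js ->] [t jt ->]]; first by exists [::]; rewrite ?big_nil.
  exists ([seq (c * p.1, p.2) | p <- s] ++ t).
    by rewrite map_cat mem_cat -map_comp negb_or jt andbT.
  rewrite big_cat big_map scaler_sumr; congr (_ + _).
  by apply: eq_bigr => p _; rewrite scalerA.
- move=> [s js E]; have [g gj gs] := finite_dual_coef js.
  have := gj; rewrite E raddf_sum big_seq big1 => [/eqP|p ps].
    by rewrite eq_sym oner_eq0.
  by rewrite /= linearZ /= gs ?mulr0 // map_f.
exists g => j'; have [<- // | jj'] := eqVneq j j'.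
apply: gM; exists [:: (1, j')]; first by rewrite inE.
by rewrite big_seq1 scale1r.
Qed.

End Density.

(** * Adjoint matrices and changes of basis *)

Section Star.
Variables (B : algType C) (st : B -> B).
Hypothesis stP : star_structure st.

(** Rectangular counterpart of [mx_star], as required for the matrices over [Z]. *)
Definition star_mx m n (x : 'M[B]_(m, n)) : 'M[B]_(n, m) :=
  \matrix_(i, j) st (x j i).

Lemma star0 : st 0 = 0.
Proof. by have [_ _ stZ _] := stP; rewrite -{1}(scale0r (0 : B)) stZ conjC0 scale0r. Qed.

Lemma star1 : st 1 = 1.
Proof.
have [stK _ _ stM] := stP.
by rewrite -[LHS]mulr1 -{2}[1]stK -stM mulr1 stK.
Qed.

Lemma star_sum (J : Type) (s : seq J) (F : J -> B) :
  st (\sum_(j <- s) F j) = \sum_(j <- s) st (F j).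
Proof.
have [_ stD _ _] := stP.
by elim/big_rec2: _ => [|j x y _ <-]; rewrite ?star0 ?stD.
Qed.

Lemma star_mxM m n p (x : 'M[B]_(m, n)) (y : 'M[B]_(n, p)) :
  star_mx (x *m y) = star_mx y *m star_mx x.
Proof.
have [_ _ _ stM] := stP.
apply/matrixP => i j; rewrite !mxE star_sum; apply: eq_bigr => k _.
by rewrite stM !mxE.
Qed.

Lemma star_alg_mx m n (Q : 'M[C]_(m, n)) :
  star_mx (map_mx (in_alg B) Q) = map_mx (in_alg B) (ctrmx Q).
Proof.
have [_ _ stZ _] := stP.
by apply/matrixP => i j; rewrite !mxE stZ star1.
Qed.

Lemma star_mx1 n : star_mx 1%:M = 1%:M :> 'M[B]_n.
Proof.
apply/matrixP => i j; rewrite !mxE eq_sym.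
by case: (i == j); rewrite ?star0 ?star1.
Qed.

End Star.

Lemma subspace_mulmx (B : algType C) (P : B -> Prop) m n p q (X : 'M[C]_(m, n))
    (u : 'M[B]_(n, p)) (Y : 'M[C]_(p, q)) :
  subspace P -> (forall i j, P (u i j)) ->
  forall i j, P ((map_mx (in_alg B) X *m u *m map_mx (in_alg B) Y) i j).
Proof.
move=> sP Pu i j; rewrite mxE; apply: subspace_sum => // k _.
rewrite mxE mulr_suml; apply: subspace_sum => // l _.
by rewrite !mxE mulr_algl mulr_algr; do 2!apply: subspaceZ => //.
Qed.

Lemma map_alg_unitmx (B : algType C) n (Q : 'M[C]_n) : Q \in unitmx ->
  map_mx (in_alg B) (invmx Q) *m map_mx (in_alg B) Q = 1%:M /\
  map_mx (in_alg B) Q *m map_mx (in_alg B) (invmx Q) = 1%:M.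
Proof. by move=> Qu; rewrite -!map_mxM mulVmx ?mulmxV // map_mx1. Qed.

Definition basis_change (B : algType C) n (Q : 'M[C]_n) (u : 'M[B]_n) : 'M[B]_n :=
  map_mx (in_alg B) (invmx Q) *m u *m map_mx (in_alg B) Q.

Lemma basis_changeK (B : algType C) n (Q : 'M[C]_n) (u : 'M[B]_n) : Q \in unitmx ->
  u = map_mx (in_alg B) Q *m basis_change Q u *m map_mx (in_alg B) (invmx Q).
Proof.
move=> /(map_alg_unitmx B)[QV VQ].
by rewrite /basis_change !mulmxA VQ mul1mx -mulmxA VQ mulmx1.
Qed.

Lemma map_basis_change (B : algType C) (f : {scalar B}) n (Q : 'M[C]_n) (u : 'M[B]_n) :
  map_mx f (basis_change Q u) = invmx Q *m map_mx f u *m Q.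
Proof. by rewrite map_scalar_mulmxr map_scalar_mulmxl. Qed.

Lemma corep_equivP (A : algType C) m n (u : 'M[A]_n) (v : 'M[A]_m) :
  corep_equiv u v -> exists e : m = n, exists2 Q : 'M[C]_n,
    Q \in unitmx & castmx (e, e) v = basis_change Q u.
Proof.
move=> [T [e rT TE]]; exists e; case: _ / e in u T rT TE *.
have Tu : T \in unitmx by rewrite -row_free_unit /row_free rT.
exists (invmx T); first by rewrite unitmx_inv.
have [_ TV] := map_alg_unitmx A Tu.
by rewrite castmx_id /basis_change invmxK TE -mulmxA TV mulmx1.
Qed.

Lemma corep_equiv_basis_change (A : algType C) n (Q : 'M[C]_n) (u : 'M[A]_n) :
  Q \in unitmx -> corep_equiv u (basis_change Q u).
Proof.
move=> Qu; have [_ QV] := map_alg_unitmx A Qu.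
exists (invmx Q); split=> //; first by rewrite mxrank_unit ?unitmx_inv.
by rewrite /basis_change -[RHS]mulmxA QV mulmx1.
Qed.

Lemma corep_equiv_refl (A : algType C) n (u : 'M[A]_n) : corep_equiv u u.
Proof. by exists 1%:M; rewrite mxrank1 map_mx1 mul1mx mulmx1. Qed.

Lemma corep_equiv_sym (A : algType C) m n (u : 'M[A]_n) (v : 'M[A]_m) :
  corep_equiv u v -> corep_equiv v u.
Proof.
move=> /corep_equivP[e [Q Qu]]; case: _ / e in u Q Qu *; rewrite castmx_id => ->.
have [QV _] := map_alg_unitmx A Qu.
exists Q; split=> //; first exact: mxrank_unit.
by rewrite [in RHS](basis_changeK u Qu) -[RHS]mulmxA QV mulmx1.
Qed.

Lemma corep_equiv_trans (A : algType C) m n p (u : 'M[A]_m) (v : 'M[A]_n)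
    (w : 'M[A]_p) : corep_equiv u v -> corep_equiv v w -> corep_equiv u w.
Proof.
move=> [T [e rT TE]] [T' [e' rT' TE']].
case: _ / e in u T rT TE *; case: _ / e' in u v T T' rT rT' TE TE' *.
exists (T' *m T); split=> //.
  by apply: mxrank_unit; rewrite unitmx_mul -!row_free_unit /row_free rT rT' eqxx.
by rewrite map_mxM -mulmxA TE mulmxA TE' mulmxA.
Qed.

(** * Unitary corepresentations and reduction to irreducible ones *)

Section Hopf.
Variables (A : algType C) (Delta : A -> seq (A * A)) (eps : A -> C).
Variables (S : A -> A) (stA : A -> A).
Hypothesis HA : is_hopf_star_algebra Delta eps S stA.
Hypothesis unitA : unitarizable Delta eps stA.

Lemma hopf_DeltaL : tlinear Delta.
Proof. by have [[]] := HA. Qed.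

Lemma hopf_epsL (c : C) x y : eps (c *: x + y) = c * eps x + eps y.
Proof. by have [_ [epsL]] := HA. Qed.

Lemma hopf_starP : star_structure stA.
Proof. by have [] := HA. Qed.

(** Substitute the sum of the [u i k ⊗ u k j] for the coproduct in the two antipode identities. *)
Lemma antipode_corep n (u : 'M[A]_n) : is_corep Delta eps u ->
  map_mx S u *m u = 1%:M /\ u *m map_mx S u = 1%:M.
Proof.
move=> [uD ue]; have [_ _ [SL Sl Sr] _ _] := HA.
split; apply/matrixP => i j; rewrite !mxE.
  have := @teq_bilinear _ _ A _ _ (fun x y => S x * y) _ _ (uD i j).
  rewrite Sl big_map big_enum ue /= => E; rewrite scaler_nat in E.
  rewrite E; last 2 first.
  - by move=> c x y v; rewrite SL mulrDl scalerAl.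
  - by move=> c x y v; rewrite mulrDr scalerAr.
  by apply: eq_bigr => k _; rewrite !mxE.
have := @teq_bilinear _ _ A _ _ (fun x y => x * S y) _ _ (uD i j).
rewrite Sr big_map big_enum ue /= => E; rewrite scaler_nat in E.
rewrite E; last 2 first.
- by move=> c x y v; rewrite mulrDl scalerAl.
- by move=> c x y v; rewrite SL mulrDr scalerAr.
by apply: eq_bigr => k _; rewrite !mxE.
Qed.

Lemma corep_basis_change n (Q : 'M[C]_n) (u : 'M[A]_n) : Q \in unitmx ->
  is_corep Delta eps u -> is_corep Delta eps (basis_change Q u).
Proof.
move=> Qu /(corepP eps hopf_DeltaL)[uD ue]; apply/(corepP eps hopf_DeltaL); split.
  by move=> f g; rewrite !map_basis_change uD !mulmxA mulmxK.
have epsE m (v : 'M[A]_m) : map_mx eps v = map_mx (counit hopf_epsL) v.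
  by apply/matrixP => i j; rewrite !mxE counitE.
by rewrite epsE map_basis_change -epsE ue mulmx1 mulVmx.
Qed.

Lemma irr_basis_change n (Q : 'M[C]_n) (u : 'M[A]_n) : Q \in unitmx ->
  irr_corep Delta eps u -> irr_corep Delta eps (basis_change Q u).
Proof.
move=> Qu [uc n0 uirr]; split=> // [|W Wst]; first exact: corep_basis_change.
have QTu : Q^T \in unitmx by rewrite unitmx_tr.
have := uirr (W *m Q^T); rewrite mxrankMfree ?row_free_unit //; apply=> f.
have := Wst f; rewrite map_basis_change !trmx_mul trmx_inv !mulmxA.
by move=> /(submxMr Q^T); rewrite mulmxKV.
Qed.

Lemma invariant_form n (u : 'M[A]_n) : is_corep Delta eps u ->
  exists H : 'M[C]_n,
    [/\ forall i j, H j i = (H i j)^*,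
        forall v : 'cV[C]_n, v != 0 -> 0 < (ctrmx v *m H *m v) 0 0
      & star_mx stA u *m map_mx (in_alg A) H *m u = map_mx (in_alg A) H].
Proof.
move=> /unitA[H [Hherm Hpos Hu]]; exists H; split=> //.
apply/matrixP => j m; rewrite [RHS]mxE /= -Hu mxE exchange_big; apply: eq_bigr => k _ /=.
rewrite !mxE mulr_suml; apply: eq_bigr => i _; rewrite !mxE.
by rewrite mulr_algr scalerAl.
Qed.

Lemma corep_unitary n (u : 'M[A]_n) : is_corep Delta eps u ->
  star_mx stA u *m u = 1%:M -> u *m star_mx stA u = 1%:M.
Proof.
move=> /antipode_corep[Su uS] uu.
suff -> : star_mx stA u = map_mx S u by [].
by rewrite -[LHS]mulmx1 -uS mulmxA uu mul1mx.
Qed.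

(** In a basis orthonormal for an invariant form [H], the invariance [u^* H u = H] becomes
    [u^* u = 1]. *)
Lemma unitarization n (u : 'M[A]_n) : is_corep Delta eps u ->
  exists2 Q, Q \in unitmx &
    star_mx stA (basis_change Q u) *m basis_change Q u = 1%:M.
Proof.
move=> uc; have [H [Hherm Hpos uH]] := invariant_form uc.
have [Q D Qu QD j|Q Qu QH] := hermitian_orthonormalization Hherm.
  have := Hpos (col j Q); rewrite -/(ctrmx _).
  have -> : (ctrmx (col j Q) *m H *m col j Q) 0 0 = D 0 j.
    have -> : col j Q = Q *m delta_mx j 0 by rewrite colE.
    have -> (e : 'cV_n) : ctrmx (Q *m e) *m H *m (Q *m e) =
        ctrmx e *m (ctrmx Q *m H *m Q) *m e by rewrite ctrmxM !mulmxA.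
    rewrite QD.
    have -> : ctrmx (delta_mx j 0) = delta_mx 0 j :> 'rV[C]_n.
      apply/matrixP => a b; rewrite !mxE andbC; case: (_ && _).
        by rewrite conjC1.
      by rewrite conjC0.
    by rewrite -rowE -colE !mxE eqxx.
  apply; apply/eqP => Qj0; have : Q *m (delta_mx j 0 : 'cV_n) = 0 by rewrite -colE.
  move=> /(congr1 (mulmx (invmx Q))); rewrite mulKmx // mulmx0.
  by move=> /matrixP/(_ j 0); rewrite !mxE !eqxx => /eqP; rewrite oner_eq0.
exists Q => //; rewrite /basis_change !(star_mxM hopf_starP) !(star_alg_mx hopf_starP).
have HE : H = ctrmx (invmx Q) *m invmx Q.
  have /(congr1 (fun X => ctrmx (invmx Q) *m X *m invmx Q)) := QH.
  by rewrite mulmx1 !mulmxA -ctrmxM mulmxV // ctrmx1 mul1mx mulmxK.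
set Qs := map_mx _ (ctrmx Q); set V := map_mx _ (ctrmx _).
have -> : Qs *m (star_mx stA u *m V) *m (map_mx (in_alg A) (invmx Q) *m u *m map_mx (in_alg A) Q)
    = Qs *m (star_mx stA u *m (V *m map_mx (in_alg A) (invmx Q)) *m u) *m map_mx (in_alg A) Q.
  by rewrite !mulmxA.
rewrite -map_mxM -HE uH.
by rewrite -!map_mxM QH map_mx1.
Qed.

(* With [X = P^-1 Q], where [P] and [Q] are the upper blocks of an invariant
   form, invariance forces [c = b X - X d]. *)
Lemma triangular_corep r s (b : 'M[A]_r) (c : 'M[A]_(r, s)) (d : 'M[A]_s) :
  is_corep Delta eps (block_mx b c 0 d) ->
  [/\ is_corep Delta eps b, is_corep Delta eps d
    & exists X : 'M[C]_(r, s),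
        c = b *m map_mx (in_alg A) X - map_mx (in_alg A) X *m d].
Proof.
move=> vc; have [vD ve] := (corepP eps hopf_DeltaL _).1 vc.
have f0 m n (f : {scalar A}) : map_mx f (0 : 'M[A]_(m, n)) = 0.
  by apply/matrixP => i j; rewrite !mxE raddf0.
have bc : is_corep Delta eps b.
  apply/(corepP eps hopf_DeltaL); split=> [f g|].
    have := vD f g; rewrite !map_block_mx mulmx_block => /eq_block_mx[-> _ _ _].
    by rewrite f0 mulmx0 addr0.
  by move: ve; rewrite map_block_mx scalar_mx_block => /eq_block_mx[].
have dc : is_corep Delta eps d.
  apply/(corepP eps hopf_DeltaL); split=> [f g|].
    have := vD f g; rewrite !map_block_mx mulmx_block => /eq_block_mx[_ _ _ ->].
    by rewrite f0 mul0mx add0r.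
  by move: ve; rewrite map_block_mx scalar_mx_block => /eq_block_mx[].
split=> //; have [H [_ Hpos vH]] := invariant_form vc.
rewrite -(submxK H) in Hpos vH; move: (ulsubmx H) (ursubmx H) (dlsubmx H) (drsubmx H) Hpos vH.
move=> P Q Q' R Hpos vH.
(* A kernel vector of [P], padded with zeros, would have length zero for a positive definite
   form. *)
have Pu : P \in unitmx.
  rewrite -unitmx_tr -row_free_unit -kermx_eq0; apply: contraT => kP.
  have := Hpos (col_mx (nz_row (kermx P^T))^T 0).
  rewrite /ctrmx map_col_mx tr_col_mx mul_row_block mul_row_col mulmx0 addr0.
  rewrite map_mx0 trmx0 !mul0mx !addr0 -mulmxA.
  rewrite (_ : P *m _ = 0) ?mulmx0 ?mxE ?ltxx.
    move=> -> //; apply: contra kP => /eqP; rewrite -col_mx0.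
    move=> /eq_col_mx[/(congr1 trmx) + _]; rewrite trmxK trmx0 => nz0.
    by rewrite -nz_row_eq0 nz0.
  apply: trmx_inj; rewrite trmx_mul trmxK trmx0; apply/sub_kermxP/nz_row_sub.
have := vH; rewrite map_block_mx.
have -> : star_mx stA (block_mx b c 0 d) =
    block_mx (star_mx stA b) 0 (star_mx stA c) (star_mx stA d).
  apply/matrixP => i j; rewrite mxE.
  have s0 := star0 hopf_starP.
  rewrite -(splitK i) -(splitK j); case: (split i) => i'; case: (split j) => j' /=;
  by rewrite ?(block_mxEul, block_mxEur, block_mxEdl, block_mxEdr) ?mxE.
(* The upper blocks of the invariance read [b^* P b = P] and [b^* P c + b^* Q d = Q]. *)
rewrite !mulmx_block !mul0mx !addr0 !mulmx0 !addr0 => /eq_block_mx[bP bQ _ _].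
have [Sb bS] := antipode_corep bc.
have bP' : star_mx stA b *m map_mx (in_alg A) P = map_mx (in_alg A) P *m map_mx S b.
  by rewrite -{2}bP -[RHS]mulmxA bS mulmx1.
have [VP PV] := map_alg_unitmx A Pu.
exists (invmx P *m Q); set X := map_mx (in_alg A) (invmx P *m Q).
have QE : map_mx (in_alg A) Q = map_mx (in_alg A) P *m X.
  by rewrite -map_mxM mulmxA mulmxV // mul1mx.
apply/eqP; rewrite eq_sym subr_eq; apply/eqP.
have E : map_mx S b *m (c + X *m d) = X.
  have := bQ; rewrite QE mulmxA bP' -!mulmxA -mulmxDr -mulmxDr.
  by move=> /(congr1 (mulmx (map_mx (in_alg A) (invmx P)))); rewrite !mulmxA VP !mul1mx.
by rewrite -{1}E mulmxA bS mul1mx.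
Qed.

(** Induction on the dimension. A basis adapted to a stable subspace makes [u] block triangular, and
    invariance expresses the off-diagonal block by the diagonal ones, which are smaller. *)
Lemma coefficient_span (P : A -> Prop) : subspace P ->
  (forall m (v : 'M[A]_m), irr_corep Delta eps v -> forall i j, P (v i j)) ->
  forall n (u : 'M[A]_n), is_corep Delta eps u -> forall i j, P (u i j).
Proof.
move=> sP Pirr n; have [N] := ubnP n; elim: N n => // N IHN n ltnN u uc.
have [[W [Wst /eqP rW0 /eqP rWn]] | noW] := pselect (exists W : 'M[C]_n,
    [/\ forall f : {scalar A}, (W *m (map_mx f u)^T <= W)%MS,
        \rank W <> 0%N & \rank W <> n]); last first.
  case: n => [|n] in ltnN u uc noW *; first by case.
  apply: Pirr; split=> // W Wst.
  have [|r0] := eqVneq (\rank W) 0%N; first by left.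
  have [|rn] := eqVneq (\rank W) n.+1; first by right.
  by case: noW; exists W; split=> //; apply/eqP.
have [r rE] : exists r, r = \rank W by exists (\rank W).
have [s nE] : exists s, n = (r + s)%N.
  by exists (n - r)%N; rewrite subnKC // rE rank_leq_row.
subst n; rewrite -rE in rW0 rWn.
(* The first [r] rows of [E] span the row space of [W], so its stability means that the lower left
   block vanishes after the change of basis. *)
pose E := row_ebase W; have Eu : E \in unitmx by apply: row_ebase_unit.
have Lu : col_ebase W \in unitmx by apply: col_ebase_unit.
have ETu : E^T \in unitmx by rewrite unitmx_tr.
have We := mulmx_ebase W; rewrite -rE in We.
have WE : (pid_mx r : 'M_(r + s)) *m E = invmx (col_ebase W) *m W.
  by apply: (canRL (mulKmx Lu)); rewrite mulmxA.
pose v := basis_change E^T u; have vc : is_corep Delta eps v by apply: corep_basis_change.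
have dl0 : dlsubmx v = 0.
  apply: map_scalar_inj => f; apply: trmx_inj.
  rewrite map_dlsubmx trmx_dlsub map_basis_change !trmx_mul trmx_inv trmxK mulmxA.
  set F := E *m _ *m _.
  have [Y YE] : exists Y : 'M_(r + s),
      (pid_mx r : 'M_(r + s)) *m F = Y *m (pid_mx r : 'M_(r + s)).
    have : ((pid_mx r : 'M_(r + s)) *m E *m (map_mx f u)^T
        <= (pid_mx r : 'M_(r + s)) *m E)%MS.
      rewrite {1}WE -mulmxA; apply: submx_trans (submxMl _ _) _.
      apply: submx_trans (Wst f) _; rewrite -[X in (X <= _)%MS]We -mulmxA.
      exact: submxMl.
    by move=> /submxP[Y YE]; exists Y; rewrite /F !mulmxA YE mulmxA mulmxK.
  move: YE; rewrite pid_mx_block -{1}(submxK F) -{1}(submxK Y) !mulmx_block.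
  rewrite !mulmx0 !mul0mx !mul1mx !addr0 => /eq_block_mx[_ -> _ _].
  by apply/matrixP => i j; rewrite !mxE raddf0.
have vE := submxK v; rewrite dl0 in vE; rewrite -vE in vc.
have [bc dc [X cE]] := triangular_corep vc.
have Pb : forall i j, P (ulsubmx v i j).
  apply: IHN => //; rewrite ltnS in ltnN; apply: leq_trans ltnN.
  by rewrite -[X in (X < _)%N]addn0 ltn_add2l lt0n; apply: contraNneq rWn => ->; rewrite addn0.
have Pd : forall i j, P (drsubmx v i j).
  apply: IHN => //; rewrite ltnS in ltnN; apply: leq_trans ltnN.
  by rewrite -[X in (X < _)%N]add0n ltn_add2r lt0n.
have alg1 m : map_mx (in_alg A) 1%:M = 1%:M :> 'M[A]_m by rewrite map_mx1.
rewrite (basis_changeK u ETu) -/v; apply: subspace_mulmx => // i j.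
rewrite -vE -(splitK i) -(splitK j); case: (split i) => i'; case: (split j) => j' /=.
- by rewrite block_mxEul.
- rewrite block_mxEur cE mxE [X in _ + X]mxE; apply: subspaceB => //.
    by rewrite -[ulsubmx v]mul1mx -alg1; apply: subspace_mulmx.
  by rewrite -[_ *m drsubmx v]mulmx1 -alg1; apply: subspace_mulmx.
- by rewrite block_mxEdl mxE; apply: sP.1.
- by rewrite block_mxEdr.
Qed.

(** One member is chosen in each class of unitary irreducible corepresentations; the index set
    consists of the fixed points of this choice. *)
Lemma irreducible_representatives :
  exists (I : eqType) (n : I -> nat) (a : forall l : I, 'M[A]_(n l)),
  [/\ forall l, irr_corep Delta eps (a l),
      forall l l', l <> l' -> ~ corep_equiv (a l) (a l'),
      forall (m : nat) (u : 'M[A]_m), irr_corep Delta eps u ->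
            exists l, corep_equiv u (a l)
    & forall l, star_mx stA (a l) *m a l = 1%:M].
Proof.
pose U := {m : nat & {u : 'M[A]_m |
  irr_corep Delta eps u /\ star_mx stA u *m u = 1%:M}}.
pose mx (x : U) : 'M[A]_(projT1 x) := sval (projT2 x).
pose equiv (x y : U) := corep_equiv (mx x) (mx y).
have ex x : exists y, equiv x y by exists x; apply: corep_equiv_refl.
pose rep x := sval (cid (ex x)).
have repP x : equiv x (rep x) by rewrite /rep; case: cid.
(* Equivalent elements define the same predicate, and proof irrelevance makes the choices from it
   coincide. *)
have rep_eq x y : equiv x y -> rep x = rep y.
  move=> xy; have exy : equiv x = equiv y.
    apply/funext => z; apply/propext; split; last exact: corep_equiv_trans.
    by apply: corep_equiv_trans; apply: corep_equiv_sym.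
  rewrite /rep; move: (ex x) (ex y); rewrite exy => h1 h2.
  by rewrite (Prop_irrelevance h1 h2).
pose I := {x : U | rep x = x}.
exists {classic I}, (fun l : I => projT1 (sval l)), (fun l : I => mx (sval l)); split.
- by move=> [[m [u [uirr uu]]] e].
- move=> [x xE] [y yE] xy /= /rep_eq; rewrite xE yE => xy'; apply: xy.
  by case: _ / xy' in yE *; congr exist; apply: Prop_irrelevance.
- move=> m u uirr; have [uc _ _] := uirr; have [Q Qu QE] := unitarization uc.
  pose x : U := existT _ m (exist _ _ (conj (irr_basis_change Qu uirr) QE)).
  have rE : rep (rep x) = rep x by rewrite -(rep_eq _ _ (repP x)).
  exists (exist _ (rep x) rE : I) => /=.
  apply: corep_equiv_trans (repP x); exact: corep_equiv_basis_change.
- by move=> [[m [u [uirr uu]]] e].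
Qed.

End Hopf.

(** * Bases from dual families, and operations on tensors *)

Section DualFamily.
Variables (V : lmodType C) (J : eqType) (x : J -> V).

Lemma subspace_spanning_family :
  (forall P, subspace P -> (forall j, P (x j)) -> forall v, P v) ->
  spanning_family x.
Proof.
move=> xP v.
have [s ->] : exists s : seq (C * J), v = \sum_(p <- s) p.1 *: x p.2.
  move: v; apply: xP => [|j]; last by exists [:: (1, j)]; rewrite big_seq1 scale1r.
  split=> [|c _ _ [s ->] [t ->]]; first by exists [::]; rewrite big_nil.
  exists ([seq (c * p.1, p.2) | p <- s] ++ t).
  rewrite big_cat big_map scaler_sumr; congr (_ + _).
  by apply: eq_bigr => p _; rewrite scalerA.
exists (size s), (fun k => (tnth (in_tuple s) k).2), (fun k => (tnth (in_tuple s) k).1).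
by rewrite (big_tnth _ _ s).
Qed.

Variable G : J -> {scalar V}.
Hypothesis Gx : forall j j', G j (x j') = (j == j')%:R.

Lemma dual_free_family : free_family x.
Proof.
move=> m f c finj E k; have := congr1 (G (f k)) E.
rewrite raddf0 raddf_sum (bigD1 k) //= linearZ /= Gx eqxx mulr1 big1 ?addr0 //.
by move=> i ik; rewrite linearZ /= Gx (inj_eq finj) eq_sym (negPf ik) mulr0.
Qed.

Lemma dual_eq0 : spanning_family x -> forall v, (forall j, G j v = 0) -> v = 0.
Proof.
move=> xspan v Gv; have [m [f [c vE]]] := xspan v.
(* The indices [f k] may repeat, hence the sum over the distinct ones. *)
suff -> : v = \sum_(j <- undup (codom f)) G j v *: x j.
  by rewrite big1 // => j _; rewrite Gv scale0r.
rewrite [in RHS]vE; under eq_bigr do rewrite raddf_sum scaler_suml.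
rewrite exchange_big vE; apply: eq_bigr => k _ /=.
rewrite (bigD1_seq (f k)) ?undup_uniq ?mem_undup ?codom_f //= linearZ /= Gx eqxx mulr1.
rewrite big1 ?addr0 // => j jk; rewrite linearZ /= Gx (negPf jk) mulr0.
by rewrite scale0r.
Qed.

End DualFamily.

Lemma teq_trans (U V : lmodType C) (s t r : seq (U * V)) :
  teq s t -> teq t r -> teq s r.
Proof. by move=> st tr f g; rewrite st tr. Qed.

Lemma teq_tmul (A B : algType C) (s s' t t' : seq (A * B)) :
  teq s s' -> teq t t' -> teq (tmul s t) (tmul s' t').
Proof.
move=> ss' tt' f g; rewrite /tmul !big_allpairs_dep /=.
transitivity (\sum_(p <- s) \sum_(q <- t') f (p.1 * q.1) * g (p.2 * q.2)).
  apply: eq_bigr => p _.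
  have [f' fE] : {F : {scalar A} | F =1 fun x => f (p.1 * x)}.
    by apply: mk_scalar => c x y; rewrite mulrDr -scalerAr linearP.
  have [g' gE] : {F : {scalar B} | F =1 fun x => g (p.2 * x)}.
    by apply: mk_scalar => c x y; rewrite mulrDr -scalerAr linearP.
  have sumE r : \sum_(q <- r) f (p.1 * q.1) * g (p.2 * q.2) = \sum_(q <- r) f' q.1 * g' q.2.
    by apply: eq_bigr => q _; rewrite fE gE.
  by rewrite !sumE; apply: tt'.
rewrite exchange_big [RHS]exchange_big; apply: eq_bigr => q _ /=.
have [f' fE] : {F : {scalar A} | F =1 fun x => f (x * q.1)}.
  by apply: mk_scalar => c x y; rewrite mulrDl -scalerAl linearP.
have [g' gE] : {F : {scalar B} | F =1 fun x => g (x * q.2)}.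
  by apply: mk_scalar => c x y; rewrite mulrDl -scalerAl linearP.
have sumE r : \sum_(p <- r) f (p.1 * q.1) * g (p.2 * q.2) = \sum_(p <- r) f' p.1 * g' p.2.
  by apply: eq_bigr => p _; rewrite fE gE.
by rewrite !sumE; apply: ss'.
Qed.

Lemma teq_star (A B : algType C) (stA : A -> A) (stB : B -> B) (s t : seq (A * B)) :
  star_structure stA -> star_structure stB -> teq s t ->
  teq [seq (stA p.1, stB p.2) | p <- s] [seq (stA p.1, stB p.2) | p <- t].
Proof.
move=> [_ AD AZ _] [_ BD BZ _] st f g; rewrite !big_map /=.
(* The star is antilinear, so a conjugation is inserted to keep the functional linear. *)
have [f' fE] : {F : {scalar A} | F =1 fun x => (f (stA x))^*}.
  by apply: mk_scalar => c x y; rewrite AD AZ linearP /= rmorphD rmorphM /= conjCK.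
have [g' gE] : {F : {scalar B} | F =1 fun x => (g (stB x))^*}.
  by apply: mk_scalar => c x y; rewrite BD BZ linearP /= rmorphD rmorphM /= conjCK.
have sumE (r : seq (A * B)) : \sum_(p <- r) f (stA p.1) * g (stB p.2) =
    (\sum_(p <- r) f' p.1 * g' p.2)^*.
  by rewrite rmorph_sum; apply: eq_bigr => p _; rewrite fE gE -rmorphM /= conjCK.
by rewrite !sumE (st f' g').
Qed.

(** * Isotypic columns of the Galois extension *)

Section Galois.
Variables (A : algType C) (Delta : A -> seq (A * A)) (eps : A -> C) (S : A -> A).
Variables (stA : A -> A).
Variables (Z : algType C) (stZ : Z -> Z) (alpha : Z -> seq (A * Z)) (mu : Z -> C).
Hypothesis HA : is_hopf_star_algebra Delta eps S stA.
Hypothesis HZ : is_star_galois Delta eps stA stZ alpha.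
Hypothesis Hmu : positive_haar_measure alpha stZ mu.
Variables (I : eqType) (n : I -> nat) (a : forall l : I, 'M[A]_(n l)).
Hypothesis airr : forall l, irr_corep Delta eps (a l).
Hypothesis aunit : forall l, star_mx stA (a l) *m a l = 1%:M.
Hypothesis aspan : forall P, subspace P -> (forall l i j, P (a l i j)) -> forall v, P v.
Variable G : {l : I & ('I_(n l) * 'I_(n l))%type} -> {scalar A}.
Hypothesis Ga : forall j j', G j (coef a j') = (j == j')%:R.

Let DeltaL := hopf_DeltaL HA.

Lemma galois_starP : star_structure stZ.
Proof. by case: HZ. Qed.

Lemma galois_alphaL : tlinear alpha.
Proof. by have [_ _ []] := HZ. Qed.

Definition ltrans (f : {scalar A}) (z : Z) : Z := \sum_(p <- alpha z) f p.1 *: p.2.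

Lemma scalar_ltrans (h : {scalar Z}) f z :
  h (ltrans f z) = \sum_(p <- alpha z) f p.1 * h p.2.
Proof. by rewrite raddf_sum; apply: eq_bigr => p _ /=; rewrite linearZ. Qed.

Lemma ltransP f c x y : ltrans f (c *: x + y) = c *: ltrans f x + ltrans f y.
Proof.
apply: functional_ext => h; rewrite linearP !scalar_ltrans.
exact: (tlinear_scalar galois_alphaL).
Qed.

Lemma ltrans_sum f (J : Type) (s : seq J) (F : J -> Z) :
  ltrans f (\sum_(j <- s) F j) = \sum_(j <- s) ltrans f (F j).
Proof.
have l0 : ltrans f 0 = 0.
  apply: (addIr (ltrans f 0)); rewrite add0r -{1}[ltrans f 0]scale1r -ltransP.
  by rewrite scale1r addr0.
by elim/big_rec2: _ => [|j x y _ <-]; rewrite ?l0 // -{1}[F j]scale1r ltransP scale1r.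
Qed.

Lemma ltransZ f c z : ltrans f (c *: z) = c *: ltrans f z.
Proof.
rewrite -[in LHS](addr0 (c *: z)) ltransP; have := ltrans_sum f [::] (fun x : Z => x).
by rewrite !big_nil => ->; rewrite addr0.
Qed.

Lemma teq_ltrans z s : teq (alpha z) s <->
  forall f, ltrans f z = \sum_(p <- s) f p.1 *: p.2.
Proof. exact: teq_l. Qed.

(** A left coaction of [A] is a right action of the convolution algebra, hence the reversed
    order. *)
Lemma ltrans_conv f g z : ltrans f (ltrans g z) = ltrans (conv DeltaL g f) z.
Proof.
have [_ _ [_ alphaA _] _ _] := HZ.
rewrite [ltrans g z]/ltrans ltrans_sum; apply: functional_ext => h.
rewrite scalar_ltrans raddf_sum /=.
have := alphaA z g f h; rewrite !big_allpairs_dep /= => E.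
transitivity (\sum_(p <- alpha z) \sum_(q <- alpha p.2) g p.1 * f q.1 * h q.2).
  apply: eq_bigr => p _; rewrite ltransZ linearZ /= scalar_ltrans mulr_sumr.
  by apply: eq_bigr => q _; rewrite mulrA.
by rewrite E; apply: eq_bigr => p _; rewrite convE mulr_suml.
Qed.

(** The hypothesis is the vanishing of all slices of the Galois image of [t]. *)
Lemma galois_inj (t : seq (Z * Z)) :
  (forall f, \sum_(p <- t) ltrans f p.1 * p.2 = 0) -> teq t [::].
Proof.
have [_ _ _ _ [binj _]] := HZ; move=> t0; apply: binj; apply/teq_l => f.
rewrite big_allpairs_dep /= big_nil -[RHS](t0 f); apply: eq_bigr => p _.
by rewrite mulr_suml; apply: eq_bigr => q _; rewrite scalerAl.
Qed.

Lemma galois_surj (s : seq (A * Z)) : exists t : seq (Z * Z),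
  forall f, \sum_(p <- t) ltrans f p.1 * p.2 = \sum_(p <- s) f p.1 *: p.2.
Proof.
have [_ _ _ _ [_ /(_ s)[t /teq_l tE]]] := HZ; exists t => f; rewrite -tE.
rewrite big_allpairs_dep; apply: eq_bigr => p _ /=.
by rewrite mulr_suml; apply: eq_bigr => q _; rewrite scalerAl.
Qed.

Lemma haarL (c : C) x y : mu (c *: x + y) = c * mu x + mu y.
Proof. by case: Hmu. Qed.

Definition haar : {scalar Z} := sval (mk_scalar haarL).

Lemma haarE z : haar z = mu z.
Proof. exact: (svalP (mk_scalar haarL)). Qed.

Lemma haar1 : haar 1 = 1.
Proof. by rewrite haarE; case: Hmu. Qed.

(** The tensors [z ⊗ 1] and [1 ⊗ z] have the same Galois image, so they are equal; [haar] is applied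
    to the second factor. *)
Lemma coinvariant_scalar z :
  (forall f, ltrans f z = f 1 *: z) -> z = haar z *: 1.
Proof.
move=> zinv; have [_ _ _ [_ /teq_ltrans alpha1 _] _] := HZ.
apply: functional_ext => h.
have /(_ h haar) : teq [:: (z, 1); (1, - z)] [::].
  apply: galois_inj => f; rewrite big_cons big_seq1 /= zinv alpha1 big_seq1 /=.
  by rewrite mulr1 -scalerAl mul1r scalerN subrr.
rewrite big_cons big_seq1 big_nil /= haar1 mulr1 raddfN mulrN => /eqP.
by rewrite subr_eq0 linearZ /= mulrC => /eqP.
Qed.

Definition intertwiner l p (z : 'M[Z]_(n l, p)) : Prop :=
  forall (f : {scalar A}) i j, ltrans f (z i j) = \sum_k f (a l i k) *: z k j.

(** Columns are finite functions so that they form a vector space over [C]. *)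
Definition isotypic l (w : {ffun 'I_(n l) -> Z}) : Prop :=
  forall (f : {scalar A}) i, ltrans f (w i) = \sum_k f (a l i k) *: w k.

Lemma subspace_isotypic l : subspace (@isotypic l).
Proof.
split=> [f i | c x y xl yl f i]; rewrite !ffunE.
  have := ltrans_sum f [::] (fun x : Z => x); rewrite !big_nil => ->.
  by rewrite big1 // => k _; rewrite ffunE scaler0.
rewrite ltransP xl yl scaler_sumr -big_split; apply: eq_bigr => k _ /=.
by rewrite !ffunE scalerDr !scalerA mulrC.
Qed.

Let ix l (i k : 'I_(n l)) := Tagged (fun l => ('I_(n l) * 'I_(n l))%type) (i, k).

(** The columns occurring when [alpha z] is expanded along the basis of coefficients of [A]. *)
Definition component l (i : 'I_(n l)) (z : Z) : {ffun 'I_(n l) -> Z} :=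
  [ffun k => ltrans (G (ix i k)) z].

(** Dual form of the coproduct of the coefficients; both sides are compared on these, which span
    [A]. *)
Lemma conv_dual l (i k : 'I_(n l)) f x :
  conv DeltaL (G (ix i k)) f x = \sum_s f (a l k s) * G (ix i s) x.
Proof.
move: x; apply: aspan => [|l' r s'].
  split=> [|c x y Ex Ey]; rewrite ?raddf0 ?linearP /=.
    by rewrite big1 // => s _; rewrite raddf0 mulr0.
  rewrite Ex Ey mulr_sumr -big_split; apply: eq_bigr => s _ /=.
  by rewrite linearP /= mulrDr mulrCA.
have [/(corepP eps DeltaL)[aD _] _ _] := airr l'.
have /matrixP/(_ r s') := aD (G (ix i k)) f; rewrite !mxE => ->.
have GE (s t : 'I_(n l)) (r' t' : 'I_(n l')) :
  G (ix s t) (a l' r' t') = (ix s t == ix r' t')%:R by rewrite -Ga.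
have [ll' | ll'] := eqVneq l l'; last first.
  have neq (s t : 'I_(n l)) (r' t' : 'I_(n l')) : (ix s t == ix r' t') = false.
    by apply/eqP => /(congr1 tag) /= /eqP; rewrite (negPf ll').
  rewrite !big1 // => t _; rewrite ?mxE GE neq ?mulr0 ?mul0r //.
case: _ / ll' in r s' GE *.
rewrite (bigD1 k) //= big1 ?addr0 => [|t tk]; last first.
  by rewrite !mxE GE eq_Tagged /= xpair_eqE [k == t]eq_sym (negPf tk) andbF mul0r.
rewrite (bigD1 s') //= big1 ?addr0 => [|t tk]; last first.
  by rewrite GE eq_Tagged /= xpair_eqE (negPf tk) andbF mulr0.
by rewrite !mxE !GE !eq_Tagged /= !xpair_eqE !eqxx !andbT mulrC.
Qed.

Lemma component_isotypic l (i : 'I_(n l)) z : isotypic (component i z).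
Proof.
move=> f k; rewrite !ffunE ltrans_conv.
under [RHS]eq_bigr do rewrite ffunE scaler_sumr.
rewrite exchange_big; apply: eq_bigr => p _ /=; rewrite conv_dual scaler_suml.
by apply: eq_bigr => s _; rewrite scalerA.
Qed.

(** The right inverse [y] is recorded because definiteness of the Gram matrix and the relation
    [z z^* = 1] both rest on it. *)
Lemma isotypic_basis l : exists p (z : 'M[Z]_(n l, p)),
  [/\ intertwiner z,
      forall c : 'cV[C]_p, z *m map_mx (in_alg Z) c = 0 -> c = 0,
      forall w, isotypic w -> exists c : 'cV[C]_p, forall i,
        w i = (z *m map_mx (in_alg Z) c) i 0
    & exists y : 'M[Z]_(p, n l), z *m y = 1%:M].
Proof.
have [_ nl0 _] := airr l; pose i0 : 'I_(n l) := Ordinal nl0.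
(* [t k0] is a Galois preimage of [a l i0 k0 ⊗ 1], for an arbitrary fixed row [i0]. *)
have /choice[t tP] (k0 : 'I_(n l)) : exists t : seq (Z * Z), forall f,
    \sum_(p <- t) ltrans f p.1 * p.2 = f (a l i0 k0) *: 1.
  by have [t tE] := galois_surj [:: (a l i0 k0, 1)]; exists t => f; rewrite tE big_seq1.
(* Slicing by the dual functionals shows that the columns [component i0 p.1] have a right inverse
   with entries [p.2]. *)
have tE k k0 : \sum_(p <- t k0) component i0 p.1 k * p.2 = (k == k0)%:R.
  under eq_bigr do rewrite ffunE; rewrite tP.
  have -> : a l i0 k0 = coef a (ix i0 k0) by [].
  by rewrite Ga eq_Tagged /= xpair_eqE eqxx /= scaler_nat.
pose s := [seq component i0 p.1 | k0 <- enum 'I_(n l), p <- t k0].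
have [m [e [g [ge gs eP]]]] := finite_dual_basis s.
have eiso j : isotypic (e j).
  apply: eP; first exact: subspace_isotypic.
  by move=> w /allpairsPdep[k0 [p [_ _ ->]]]; apply: component_isotypic.
have component_s k0 : {in t k0, forall p, component i0 p.1 \in s}.
  by move=> p pt; apply/allpairsPdep; exists k0, p; rewrite mem_enum.
(* [w k ⊗ 1] and the sum of the [component i0 p.1 k ⊗ p.2 * w k0] have the same Galois image; [haar]
   turns the second factors into scalars. *)
have wE w : isotypic w ->
    w = \sum_k0 \sum_(p <- t k0) haar (p.2 * w k0) *: component i0 p.1.
  move=> wiso; apply/ffunP => k; apply: functional_ext => h.
  pose t' := (w k, 1) ::
    [seq (component i0 p.1 k, - (p.2 * w k0)) | k0 <- enum 'I_(n l), p <- t k0].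
  have /(_ h haar) : teq t' [::].
    apply: galois_inj => f; rewrite big_cons big_allpairs_dep big_enum /= mulr1.
    rewrite wiso; apply/eqP; rewrite addr_eq0; apply/eqP.
    transitivity (\sum_k0 \sum_(p <- t k0) \sum_s0 f (a l k s0) *:
                    (component i0 p.1 s0 * p.2 * w k0)); last first.
      rewrite -sumrN; apply: eq_bigr => k0 _; rewrite -sumrN; apply: eq_bigr => p _.
      rewrite component_isotypic mulr_suml -sumrN; apply: eq_bigr => s0 _.
      by rewrite mulrN opprK -scalerAl mulrA.
    transitivity (\sum_k0 \sum_s0 f (a l k s0) *: ((s0 == k0)%:R * w k0)).
      rewrite exchange_big; apply: eq_bigr => s0 _ /=.
      rewrite (bigD1 s0) //= eqxx mul1r big1 ?addr0 // => k0 /negPf k0s0.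
      by rewrite eq_sym k0s0 mul0r scaler0.
    apply: eq_bigr => k0 _; rewrite exchange_big; apply: eq_bigr => s0 _ /=.
    by rewrite -scaler_sumr -mulr_suml tE.
  rewrite big_cons big_allpairs_dep big_enum big_nil /= haar1 mulr1 => /eqP.
  rewrite addr_eq0 => /eqP ->; rewrite sum_ffunE -sumrN raddf_sum.
  apply: eq_bigr => k0 _ /=; rewrite sum_ffunE -sumrN raddf_sum.
  apply: eq_bigr => p _ /=; rewrite !ffunE [RHS]linearZ /= [haar (- _)]raddfN mulrN opprK mulrC.
  by [].
have gE w : isotypic w -> w = \sum_j g j w *: e j.
  pose P (w : {ffun 'I_(n l) -> Z}) := w = \sum_j g j w *: e j.
  have sP : subspace P.
    split=> [|c x y Px Py]; rewrite /P.
      by rewrite big1 // => j _; rewrite raddf0 scale0r.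
    rewrite {1}Px {1}Py scaler_sumr -big_split; apply: eq_bigr => j _ /=.
    by rewrite linearP scalerDl scalerA.
  move=> /wE ->; apply: (subspace_sum sP) => k0 _; rewrite big_seq.
  by apply: (subspace_sum sP) => p pt; apply: subspaceZ => //; apply/gs/component_s/pt.
exists m, (\matrix_(i, j) e j i); split.
- by move=> f i j; rewrite mxE eiso; apply: eq_bigr => k _; rewrite mxE.
- move=> c c0; apply/colP => j; rewrite [RHS]mxE.
  have : \sum_j c j 0 *: e j = 0.
    apply/ffunP => i; rewrite sum_ffunE [RHS]ffunE.
    have := congr1 (fun X : 'cV[Z]_(n l) => X i 0) c0; rewrite /= !mxE => E0.
    rewrite -[RHS]E0.
    by apply: eq_bigr => j' _; rewrite !mxE ffunE mulr_algr.
  move=> /(congr1 (g j)); rewrite raddf0 raddf_sum (bigD1 j) //= linearZ /= ge eqxx.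
  rewrite mulr1 big1 ?addr0 // => j' j'j.
  by rewrite linearZ /= ge eq_sym (negPf j'j) mulr0.
- move=> w wiso; exists (\col_j g j w) => i; rewrite {1}(gE w wiso) sum_ffunE mxE.
  by apply: eq_bigr => j _; rewrite !mxE ffunE mulr_algr.
- exists (\matrix_(j, k0) \sum_(p <- t k0) g j (component i0 p.1) *: p.2).
  apply/matrixP => k k0; rewrite !mxE -tE.
  transitivity (\sum_j \sum_(p <- t k0) (g j (component i0 p.1) *: e j k) * p.2).
    apply: eq_bigr => j _; rewrite !mxE mulr_sumr; apply: eq_bigr => p _.
    by rewrite -scalerAr scalerAl.
  rewrite exchange_big !big_seq; apply: eq_bigr => p pt /=.
  rewrite -mulr_suml [in RHS](gs _ (component_s k0 p pt)) sum_ffunE.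
  by congr (_ * _); apply: eq_bigr => j _; rewrite ffunE.
Qed.

Lemma map_haar_alg m p (X : 'M[C]_(m, p)) : map_mx haar (map_mx (in_alg Z) X) = X.
Proof. by apply/matrixP => i j; rewrite !mxE linearZ /= haar1 mulr1. Qed.

Lemma intertwiner_mulr l p q (z : 'M[Z]_(n l, p)) (Q : 'M[C]_(p, q)) :
  intertwiner z -> intertwiner (z *m map_mx (in_alg Z) Q).
Proof.
move=> zint f i j; rewrite mxE ltrans_sum.
transitivity (\sum_k \sum_s f (a l i s) *: (Q k j *: z s k)).
  apply: eq_bigr => k _; rewrite mxE mulr_algr ltransZ zint scaler_sumr.
  by apply: eq_bigr => s _; rewrite !scalerA mulrC.
rewrite exchange_big; apply: eq_bigr => s _ /=; rewrite mxE scaler_sumr.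
by apply: eq_bigr => k _; rewrite mxE mulr_algr.
Qed.

(** Unitarity of [a l] makes the entries of [z^* z] coinvariant, hence scalar. *)
Lemma intertwiner_gram l p (z : 'M[Z]_(n l, p)) : intertwiner z ->
  star_mx stZ z *m z =
    map_mx (in_alg Z) (\matrix_(j, k) haar ((star_mx stZ z *m z) j k)).
Proof.
move=> zint; apply/matrixP => j k; rewrite [RHS]mxE /= [in RHS]mxE.
apply: coinvariant_scalar => f; rewrite mxE ltrans_sum.
have [_ _ _ [alphaM _ alphaS] _] := HZ.
have zteq i j' : teq (alpha (z i j')) [seq (a l i s, z s j') | s <- enum 'I_(n l)].
  by apply/teq_ltrans => g; rewrite big_map big_enum /= zint.
have E i : ltrans f (star_mx stZ z j i * z i k) =
    \sum_s \sum_t f (stA (a l i s) * a l i t) *: (stZ (z s j) * z t k).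
  rewrite mxE; have sz : teq (alpha (stZ (z i j)))
      [seq (stA p.1, stZ p.2) | p <- [seq (a l i s, z s j) | s <- enum 'I_(n l)]].
    apply: teq_trans (alphaS _) _; apply: teq_star (zteq i j).
      exact: hopf_starP HA.
    exact: galois_starP.
  have /teq_ltrans-> := teq_trans (alphaM _ _) (teq_tmul sz (zteq i k)).
  rewrite /tmul big_allpairs_dep /= big_map big_map big_enum; apply: eq_bigr => s _ /=.
  by rewrite big_map big_enum.
under eq_bigr do rewrite E.
have aa s t : \sum_i stA (a l i s) * a l i t = (s == t)%:R.
  have /matrixP/(_ s t) := aunit l; rewrite !mxE => <-.
  by apply: eq_bigr => i _; rewrite mxE.
rewrite exchange_big [in RHS]scaler_sumr; apply: eq_bigr => s _ /=.
rewrite exchange_big (bigD1 s) //= [X in _ + X]big1 ?addr0 => [|t ts].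
  by rewrite -scaler_suml -raddf_sum /= aa eqxx mxE.
by rewrite -scaler_suml -raddf_sum /= aa eq_sym (negPf ts) raddf0 scale0r.
Qed.

Lemma orthonormal_isotypic_basis l : exists p (z : 'M[Z]_(n l, p)),
  [/\ (0 < p)%N, intertwiner z,
      forall w, isotypic w -> exists c : 'cV[C]_p, forall i,
        w i = (z *m map_mx (in_alg Z) c) i 0,
      star_mx stZ z *m z = 1%:M
    & z *m star_mx stZ z = 1%:M].
Proof.
have [p [z [zint zfree zspan [y zy]]]] := isotypic_basis l.
have stP := galois_starP; have [_ _ _ mu_ge0] := Hmu.
have [stK _ _ _] := stP.
have starK m q (x : 'M[Z]_(m, q)) : star_mx stZ (star_mx stZ x) = x.
  by apply/matrixP => i j; rewrite !mxE stK.
have p_gt0 : (0 < p)%N.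
  have [_ nl0 _] := airr l; case: p => [|//] in z zint zfree zspan y zy *.
  have /matrixP/(_ (Ordinal nl0) (Ordinal nl0)) := zy.
  by rewrite !mxE big_ord0 eqxx => /esym/eqP; rewrite oner_eq0.
set H := \matrix_(j, k) haar ((star_mx stZ z *m z) j k).
have zH : star_mx stZ z *m z = map_mx (in_alg Z) H by apply: intertwiner_gram.
have zQ q (Q : 'M[C]_(p, q)) :
    star_mx stZ (z *m map_mx (in_alg Z) Q) *m (z *m map_mx (in_alg Z) Q) =
    map_mx (in_alg Z) (ctrmx Q *m H *m Q).
  rewrite (star_mxM stP) (star_alg_mx stP) !mulmxA -[_ *m _ *m z]mulmxA zH.
  by rewrite !map_mxM.
have zQy Q : Q \in unitmx ->
    (z *m map_mx (in_alg Z) Q) *m (map_mx (in_alg Z) (invmx Q) *m y) = 1%:M.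
  move=> /(map_alg_unitmx Z)[_ QV].
  by rewrite -mulmxA [_ *m (_ *m y)]mulmxA QV mul1mx.
have Hherm i j : H j i = (H i j)^*.
  suff HE : H = ctrmx H by rewrite {1}HE /ctrmx [LHS]mxE [LHS]mxE.
  rewrite -[LHS]map_haar_alg -[RHS]map_haar_alg -(star_alg_mx stP) -zH.
  by rewrite (star_mxM stP) starK.
have [Q D Qu QD j | Q Qu QH] := hermitian_orthonormalization Hherm.
  have [x xE] : exists x, x = z *m map_mx (in_alg Z) Q by exists (z *m map_mx (in_alg Z) Q).
  have xx : star_mx stZ x *m x = map_mx (in_alg Z) (diag_mx D) by rewrite xE zQ QD.
  rewrite lt0r; apply/andP; split.
    apply/eqP => Dj0.
    (* With [y'] the right inverse of [x], [x = (x y')^* x = y'^* x^* x], so a zero of [D] at [j]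
       kills column [j] of [x], against independence of the columns of [z]. *)
    have xj0 : x *m delta_mx j (0 : 'I_1) = 0.
      rewrite -[LHS]mul1mx -(star_mx1 stP) -(zQy Q Qu) -xE (star_mxM stP).
      rewrite -mulmxA [star_mx _ x *m _]mulmxA xx.
      suff -> : map_mx (in_alg Z) (diag_mx D) *m delta_mx j (0 : 'I_1) = 0 by rewrite mulmx0.
      rewrite -(map_delta_mx (in_alg Z)) -map_mxM -colE (_ : col j _ = 0) ?map_mx0 //.
      apply/colP => i; rewrite !mxE; case: eqP => [->|_]; last by rewrite mulr0n.
      by rewrite Dj0 mul0rn.
    have : Q *m (delta_mx j (0 : 'I_1)) = 0.
      by apply: zfree; rewrite map_mxM mulmxA -xE map_delta_mx.
    move=> /(congr1 (mulmx (invmx Q))); rewrite mulKmx // mulmx0.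
    by move=> /matrixP/(_ j 0); rewrite !mxE !eqxx => /eqP; rewrite oner_eq0.
  have -> : D 0 j = haar ((star_mx stZ x *m x) j j).
    by rewrite xx !mxE eqxx mulr1n linearZ /= haar1 mulr1.
  rewrite mxE raddf_sum; apply: sumr_ge0 => i _ /=.
  by rewrite haarE mxE.
exists p, (z *m map_mx (in_alg Z) Q).
have xx : star_mx stZ (z *m map_mx (in_alg Z) Q) *m (z *m map_mx (in_alg Z) Q) = 1%:M.
  by rewrite zQ QH map_mx1.
split=> //; first exact: intertwiner_mulr.
  move=> w /zspan[c wE]; exists (invmx Q *m c) => i.
  by rewrite wE -mulmxA -map_mxM mulmxA mulmxV // mul1mx.
(* A left inverse and a right inverse coincide, so the adjoint is two-sided. *)
suff -> : star_mx stZ (z *m map_mx (in_alg Z) Q) = map_mx (in_alg Z) (invmx Q) *m y.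
  exact: zQy.
by rewrite -[LHS]mulmx1 -(zQy Q Qu) [LHS]mulmxA xx mul1mx.
Qed.

(** * Entries of the isotypic matrices as a basis of [Z] *)

Section IsotypicFamily.
Variables (p : I -> nat) (z : forall l, 'M[Z]_(n l, p l)).
Hypothesis zint : forall l, intertwiner (z l).
Hypothesis zspan : forall l w, isotypic w -> exists c : 'cV[C]_(p l),
  forall i, w i = (z l *m map_mx (in_alg Z) c) i 0.
Hypothesis zz : forall l, star_mx stZ (z l) *m z l = 1%:M.

Let zfam (x : {l : I & ('I_(n l) * 'I_(p l))%type}) :=
  z (projT1 x) (projT2 x).1 (projT2 x).2.

(** Slicing by [G] selects [l] and [i], multiplication by the adjoint of column [j] selects [j]
    through [z^* z = 1], and [haar] sends 1 to 1. *)
Lemma isotypic_dual : exists h : {l : I & ('I_(n l) * 'I_(p l))%type} -> {scalar Z},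
  forall x x', h x (zfam x') = (x == x')%:R.
Proof.
suff /choice[h hP] x : exists h : {scalar Z}, forall x', h (zfam x') = (x == x')%:R.
  by exists h.
case: x => l [i j].
have [h hE] : {F : {scalar Z} |
    F =1 fun v => haar (\sum_k stZ (z l k j) * ltrans (G (ix i k)) v)}.
  apply: mk_scalar => c u v; rewrite -linearP /=; congr (haar _).
  rewrite scaler_sumr -big_split; apply: eq_bigr => k _ /=.
  by rewrite ltransP mulrDr scalerAr.
exists h => [[l' [i' j']]]; rewrite hE /zfam /=.
have GE (s t : 'I_(n l)) (r' t' : 'I_(n l')) :
  G (ix s t) (a l' r' t') = (ix s t == ix r' t')%:R by rewrite -Ga.
have [ll' | ll'] := eqVneq l l'; last first.
  rewrite big1 ?raddf0 => [|k _].
    by case: eqP => // /(congr1 tag) /= /eqP; rewrite (negPf ll').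
  rewrite zint big1 ?mulr0 // => s _; rewrite GE.
  case: eqP => [/(congr1 tag) /= /eqP|_]; last by rewrite scale0r.
  by rewrite (negPf ll').
case: _ / ll' in i' j' GE *.
have E k : ltrans (G (ix i k)) (z l i' j') = (i == i')%:R *: z l k j'.
  rewrite zint (bigD1 k) //= big1 ?addr0 => [|s sk]; rewrite GE eq_Tagged /= xpair_eqE.
    by rewrite eqxx andbT.
  by rewrite [k == s]eq_sym (negPf sk) andbF scale0r.
under eq_bigr do rewrite E -scalerAr; rewrite -scaler_sumr.
have /matrixP/(_ j j') := zz l; rewrite !mxE => zzE.
rewrite (eq_bigr (fun k => star_mx stZ (z l) j k * z l k j')); last first.
  by move=> k _; rewrite mxE.
rewrite zzE linearZ /= eq_Tagged /= xpair_eqE.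
case: (i == i') => /=; last by rewrite mul0r.
by case: (j == j'); rewrite ?haar1 ?raddf0 mul1r.
Qed.

(** If [f] vanishes on [P], the slice [X] of [alpha v] by [f] has zero coordinates, since these are
    values of [f] on entries of isotypic columns. So [X = 0], and its counit is [f v]. *)
Lemma isotypic_span P : subspace P -> (forall x, P (zfam x)) -> forall v, P v.
Proof.
move=> sP Pz v; apply: contrapT => nPv.
have [f fv fP] := separating_functional sP nPv.
have [_ _ [_ _ counitZ] _ _] := HZ.
have := fv; rewrite -(counitZ v) raddf_sum.
pose X := \sum_(q <- alpha v) f q.2 *: q.1.
have X0 : X = 0.
  apply: (dual_eq0 Ga); first apply: subspace_spanning_family.
    by move=> Q sQ Qa; apply: aspan => // l i k; have := Qa (ix i k).
  move=> [l [i k]]; rewrite raddf_sum.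
  transitivity (f (component i v k)).
    rewrite ffunE scalar_ltrans; apply: eq_bigr => q _ /=.
    by rewrite linearZ /= mulrC.
  have [c ->] := zspan (component_isotypic i v); apply: fP; rewrite mxE.
  apply: subspace_sum => // j _; rewrite mxE mulr_algr; apply: subspaceZ => //.
  exact: (Pz (Tagged (fun l => ('I_(n l) * 'I_(p l))%type) (k, j))).
have -> : \sum_(q <- alpha v) f (eps q.1 *: q.2) = counit (hopf_epsL HA) X.
  rewrite raddf_sum; apply: eq_bigr => q _ /=.
  by rewrite !linearZ /= counitE mulrC.
by rewrite X0 raddf0 => /eqP; rewrite eq_sym oner_eq0.
Qed.

End IsotypicFamily.

End Galois.

(** * Assembly of the bases of [A] and [Z] *)

Theorem theorem5p1p1
  (A : algType C) (Delta : A -> seq (A * A)) (eps : A -> C) (S : A -> A)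
  (stA : A -> A)
  (Z : algType C) (stZ : Z -> Z) (alpha : Z -> seq (A * Z)) (mu : Z -> C) :
  is_hopf_star_algebra Delta eps S stA ->
  unitarizable Delta eps stA ->
  is_star_galois Delta eps stA stZ alpha ->
  positive_haar_measure alpha stZ mu ->
  (* I indexes \widehat A via the irreducible corepresentations a λ,
     n λ = n_λ, and Z(λ) = span of the z λ i j *)
  exists (I : Type) (n p : I -> nat)
         (z : forall l : I, 'M[Z]_(n l, p l)) (a : forall l : I, 'M[A]_(n l)),
  [/\ (* I ≃ \widehat A : the a λ form a complete set of representatives of
         the isomorphism classes of irreducible finite-dimensional comodules *)
      [/\ forall l, irr_corep Delta eps (a l),
          forall l l', l <> l' -> ~ corep_equiv (a l) (a l')
        & forall (m : nat) (u : 'M[A]_m), irr_corep Delta eps u ->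
            exists l, corep_equiv u (a l)],
      (* p λ > 0, and Z = ⊕_λ Z(λ) with the z^λ_ij a basis of Z *)
      (forall l, (0 < p l)%N),
      basis_family (fun x : {l : I & ('I_(n l) * 'I_(p l))%type} =>
                      z (projT1 x) (projT2 x).1 (projT2 x).2),
      (* the orthogonality relations *)
      [/\ forall l (j k : 'I_(p l)),
            \sum_(i < n l) stZ (z l i j) * z l i k = (j == k)%:R
        & forall l (i k : 'I_(n l)),
            \sum_(j < p l) z l i j * stZ (z l k j) = (i == k)%:R]
    & (* the a^λ_ij form a basis of A, each a λ is unitary, and
         α_Z(z^λ_ij) = Σ_k a^λ_ik ⊗ z^λ_kj *)
      [/\ basis_family (fun x : {l : I & ('I_(n l) * 'I_(n l))%type} =>
                          a (projT1 x) (projT2 x).1 (projT2 x).2),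
          forall l, mx_star stA (a l) *m a l = 1%:M /\
                    a l *m mx_star stA (a l) = 1%:M
        & forall l (i : 'I_(n l)) (j : 'I_(p l)),
            teq (alpha (z l i j)) [seq (a l i k, z l k j) | k <- enum 'I_(n l)]]].
Proof.
move=> HA unitA HZ Hmu.
have [I [n [a [airr aneq acomp aunit]]]] := irreducible_representatives HA unitA.
have [[_ _ _ DeltaA] [_ _ _ counitl counitr] _ _ _] := HA.
have aspan P : subspace P -> (forall l i j, P (a l i j)) -> forall v, P v.
  move=> sP Pa v.
  have [m [u [c [uc ->]]]] :=
    mem_coefficients (hopf_DeltaL HA) DeltaA (hopf_epsL HA) counitl counitr v.
  apply: subspace_sum => // i _; apply: subspace_sum => // j _; apply: subspaceZ => //.
  (* Every irreducible corepresentation is conjugate to some [a l], so its coefficients are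
     combinations of those of [a l]. *)
  apply: (coefficient_span HA unitA sP) uc i j => k w /acomp[l].
  move=> /corep_equiv_sym/corep_equivP[e [Q Qu wE]].
  subst k; rewrite castmx_id in wE; rewrite wE.
  exact: subspace_mulmx.
have [G Ga] := dual_coef (hopf_DeltaL HA) (hopf_epsL HA) airr aneq.
have zex l := orthonormal_isotypic_basis HA HZ Hmu airr aunit aspan Ga l.
pose p l := sval (cid (zex l)); pose z l : 'M[Z]_(n l, p l) := sval (cid (svalP (cid (zex l)))).
have zP l := svalP (cid (svalP (cid (zex l)))).
have zint l : intertwiner alpha a (z l) by case: (zP l).
have zz l : star_mx stZ (z l) *m z l = 1%:M by case: (zP l).
have zspan l w : isotypic alpha a w -> exists c : 'cV[C]_(p l),
    forall i, w i = (z l *m map_mx (in_alg Z) c) i 0.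
  by case: (zP l) => _ _ + _ _; apply.
exists I, n, p, z, a; split=> //.
- by move=> l; case: (zP l).
- split.
    have [h hz] := isotypic_dual HZ Hmu Ga zint zz.
    exact: dual_free_family hz.
  apply: subspace_spanning_family => P sP Pz.
  exact: (isotypic_span HA HZ airr aspan Ga zspan sP Pz).
- split=> l j k.
    have /matrixP/(_ j k) := zz l; rewrite !mxE => <-.
    by apply: eq_bigr => i _; rewrite mxE.
  have [_ _ _ _ /matrixP/(_ j k)] := zP l; rewrite !mxE => <-.
  by apply: eq_bigr => i _; rewrite mxE.
- split=> [|l|l i j].
  + split; first exact: dual_free_family Ga.
    apply: subspace_spanning_family => P sP Pa; apply: aspan => // l i j.
    exact: (Pa (Tagged (fun l => ('I_(n l) * 'I_(n l))%type) (i, j))).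
  + split; first exact: aunit.
    by apply: (corep_unitary HA) => //; case: (airr l).
  + by apply/teq_ltrans => f; rewrite big_map big_enum /= zint.
Qed.
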